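(* (i) The set $S$ of homogeneous regular elements in $\mathcal{B}$ satisfies the left and right Ore conditions in $\mathcal{B}$. (ii) The ring of fractions $Q := \mathcal{B}S^{-1}$ is equipped with a structure of superalgebra whose even part is $Q_0 = \mathcal{B}_0 S_0^{-1}$, and we have $Q = \mathcal{B}S_0^{-1}$. (iii) The superalgebra $Q$ is a super-simple super-artinian ring.
   Context: Let $\Bbbk$ be a (commutative) field of characteristic $p \neq 2$ ($p=0$ is allowed). The super Jordan plane $\mathcal{B}$ is the associative unital $\Bbbk$-algebra presented by generators $x, y$ with defining relations $x^2 = 0$ and $yz - zy - xz = 0$, where $z = xy + yx$. The relations are homogeneous for $\deg x = \deg y = 1$, so $\mathcal{B}$ is $\mathbb{Z}$-graded, and it is a superalgebra ($\mathbb{Z}/2\mathbb{Z}$-graded algebra) $\mathcal{B} = \mathcal{B}_0 \oplus \mathcal{B}_1$, where $\mathcal{B}_0$ (respectively $\mathcal{B}_1$) is the sum of the components of even (respectively odd) degree. ''Homogeneous'' refers to this $\mathbb{Z}/2\mathbb{Z}$-grading. An element is regular in a ring if it is neither a left nor a right zero divisor in it ($0$ counts as a zero divisor). $S_0$ is the set of regular elements of the ring $\mathcal{B}_0$; it satisfies the left and right Ore conditions in $\mathcal{B}_0$, and $\mathcal{B}_0 S_0^{-1}$ is the total ring of fractions of $\mathcal{B}_0$. $S$ is the set of elements of $\mathcal{B}_0 \cup \mathcal{B}_1$ that are regular in $\mathcal{B}$. Both $S_0$ and $S$ are multiplicative sets. A superalgebra (i.e. $\mathbb{Z}/2\mathbb{Z}$-graded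 algebra) is super-simple if it is nonzero and has no two-sided graded ideals other than $0$ and itself; it is super-artinian if it satisfies the descending chain condition on graded left ideals and on graded right ideals. *)

(* Defs.v *)
From HB Require Import structures.
From mathcomp Require Import all_boot all_algebra.
From mathcomp Require Import boolp classical_sets.
From mathcomp Require Import finmap monalg.

Set Implicit Arguments.
Unset Strict Implicit.
Unset Printing Implicit Defensive.

Import GRing.Theory.
Local Open Scope classical_set_scope.
Local Open Scope quotient_scope.
Local Open Scope ring_scope.

(* -------------------------------------------------------------------- *)
Section Ideals.
Context (R : pzRingType).
Implicit Types (I X : set R).

Definition left_ideal I : Prop :=
  [/\ I 0, forall a b, I a -> I b -> I (a + b)
     & forall r a, I a -> I (r * a)].

Definition right_ideal I : Prop :=
  [/\ I 0, forall a b, I a -> I b -> I (a + b)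
     & forall r a, I a -> I (a * r)].

Definition twosided_ideal I : Prop := left_ideal I /\ right_ideal I.

Definition ideal_gen X : set R :=
  [set a | forall I, twosided_ideal I -> X `<=` I -> I a].

Lemma ideal_gen_ideal X : twosided_ideal (ideal_gen X).
Proof.
split; split.
- by move=> I [[I0 _ _] _] _.
- by move=> a b ha hb I hI XI; case: (hI) => -[_ + _] _; apply; [exact: ha|exact: hb].
- by move=> r a ha I hI XI; case: (hI) => -[_ _ +] _; apply; exact: ha.
- by move=> I [[I0 _ _] _] _.
- by move=> a b ha hb I hI XI; case: (hI) => -[_ + _] _; apply; [exact: ha|exact: hb].
- by move=> r a ha I hI XI; case: (hI) => _ [_ _ +]; apply; exact: ha.
Qed.

End Ideals.

(* -------------------------------------------------------------------- *)
(* The algebra k<x, y | x^2, yz - zy - xz>, with z = xy + yx, as the quotient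
   of the free algebra {malg k[{fmonom bool}]} (formal k-linear combinations of
   words over bool, where false and true stand for x and y) by the two-sided
   ideal generated by the relators.                                        *)
Section SuperJordanPlane.
Context (k : fieldType).
Local Notation FA := {malg k[{fmonom bool}]}.

Definition free_x : FA := << fmu false >>.
Definition free_y : FA := << fmu true >>.
Definition free_z : FA := free_x * free_y + free_y * free_x.

Definition sjp_relators : set FA :=
  [set free_x ^+ 2] `|` [set free_y * free_z - free_z * free_y - free_x * free_z].

Definition sjp_ideal (f : FA) : bool := `[< ideal_gen sjp_relators f >].

Lemma sjp_ideal_left : left_ideal [set f | sjp_ideal f].
Proof.
have [[I0 ID IM] _] := ideal_gen_ideal sjp_relators.
split => /= [|a b /asboolP ha /asboolP hb|r a /asboolP ha]; apply/asboolP.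
- exact: I0.
- exact: ID.
- exact: IM.
Qed.

Lemma sjp_ideal_right : right_ideal [set f | sjp_ideal f].
Proof.
have [_ [I0 ID IM]] := ideal_gen_ideal sjp_relators.
split => /= [|a b /asboolP ha /asboolP hb|r a /asboolP ha]; apply/asboolP.
- exact: I0.
- exact: ID.
- exact: IM.
Qed.

Lemma sjp_ideal_zmod : zmod_closed sjp_ideal.
Proof.
have [I0 ID IM] := sjp_ideal_left.
split => [|a b ha hb]; first exact: I0.
by apply: ID => //; rewrite -mulN1r; apply: IM.
Qed.

HB.instance Definition _ := GRing.isZmodClosed.Build FA sjp_ideal sjp_ideal_zmod.

Definition sjp_zideal : zmodClosed FA := GRing.ZmodClosed.clone FA sjp_ideal _.

Definition super_jordan_plane := Quotient.quot sjp_zideal.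
Local Notation B := super_jordan_plane.

HB.instance Definition _ := GRing.Zmodule.on B.

Definition sjp_proj (f : FA) : B := \pi_(Quotient.quot sjp_zideal) f.

Lemma sjp_projE f g : (sjp_proj f = sjp_proj g) <-> sjp_ideal (f - g).
Proof.
split=> [/eqP|h]; first by rewrite /sjp_proj -Quotient.idealrBE.
by apply/eqP; rewrite /sjp_proj -Quotient.idealrBE.
Qed.

Definition sjp_repr (a : B) : FA := repr (a : Quotient.quot sjp_zideal).

Lemma sjp_reprK : cancel sjp_repr sjp_proj.
Proof. by move=> a; rewrite /sjp_proj /sjp_repr reprK. Qed.

Lemma sjp_projK f : sjp_ideal (sjp_repr (sjp_proj f) - f).
Proof. by apply/sjp_projE; rewrite sjp_reprK. Qed.

Lemma sjp_projD f g : sjp_proj (f + g) = sjp_proj f + sjp_proj g.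
Proof. exact: (raddfD \pi_(Quotient.quot sjp_zideal)). Qed.

Lemma sjp_proj0 : sjp_proj 0 = 0.
Proof. exact: (raddf0 \pi_(Quotient.quot sjp_zideal)). Qed.

Definition sjp_mul (a b : B) : B := sjp_proj (sjp_repr a * sjp_repr b).
Definition sjp_scale (c : k) (a : B) : B := sjp_proj (c *: sjp_repr a).

Lemma sjp_projM f g : sjp_proj (f * g) = sjp_mul (sjp_proj f) (sjp_proj g).
Proof.
have [[_ ID IL] [_ _ IR]] := (sjp_ideal_left, sjp_ideal_right).
apply/esym/sjp_projE; set f' := sjp_repr _; set g' := sjp_repr _.
have -> : f' * g' - f * g = (f' - f) * g' + f * (g' - g).
  by rewrite mulrBl mulrBr addrA subrK.
by apply: ID; [apply: IR|apply: IL]; exact: sjp_projK.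
Qed.

Lemma sjp_projZ c f : sjp_proj (c *: f) = sjp_scale c (sjp_proj f).
Proof.
have [_ _ IL] := sjp_ideal_left.
apply/esym/sjp_projE; rewrite -scalerBr -mul_malgC; apply: IL.
exact: sjp_projK.
Qed.

Lemma free_scaleAr (c : k) (f g : FA) : c *: (f * g) = f * (c *: g).
Proof.
apply/malgP => m; rewrite mcoeffZ mcoeffMl.
rewrite (mcoeffMlw _ (fsubset_refl (msupp f)) (msuppZ_le c g)).
rewrite mulr_sumr; apply: eq_bigr => m1 _; rewrite mulr_sumr.
by apply: eq_bigr => m2 _; rewrite mcoeffZ mulrnAr mulrCA.
Qed.

Lemma sjp_mulA : associative sjp_mul.
Proof.
move=> a b c; rewrite -[a]sjp_reprK -[b]sjp_reprK -[c]sjp_reprK.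
by rewrite -!sjp_projM mulrA.
Qed.

Lemma sjp_mul1 : left_id (sjp_proj 1) sjp_mul.
Proof. by move=> a; rewrite -[a]sjp_reprK -sjp_projM mul1r. Qed.

Lemma sjp_mulr1 : right_id (sjp_proj 1) sjp_mul.
Proof. by move=> a; rewrite -[a]sjp_reprK -sjp_projM mulr1. Qed.

Lemma sjp_mulDl : left_distributive sjp_mul +%R.
Proof.
move=> a b c; rewrite -[a]sjp_reprK -[b]sjp_reprK -[c]sjp_reprK.
by rewrite -sjp_projD -!sjp_projM mulrDl sjp_projD.
Qed.

Lemma sjp_mulDr : right_distributive sjp_mul +%R.
Proof.
move=> a b c; rewrite -[a]sjp_reprK -[b]sjp_reprK -[c]sjp_reprK.
by rewrite -sjp_projD -!sjp_projM mulrDr sjp_projD.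
Qed.

Lemma sjp_oner_neq0 : sjp_proj 1 != 0.
Proof.
apply/eqP; rewrite -sjp_proj0 sjp_projE subr0 => /asboolP.
have hI : twosided_ideal [set f : FA | f@_mone = 0].
  split; split=> /= [|a b ha hb|r a ha]; rewrite ?mcoeff0 //.
  - by rewrite mcoeffD ha hb addr0.
  - by rewrite rmorphM /= ha mulr0.
  - by rewrite mcoeffD ha hb addr0.
  - by rewrite rmorphM /= ha mul0r.
have hx : free_x@_mone = 0 by rewrite mcoeffU1 fm1_eq1.
have hy : free_y@_mone = 0 by rewrite mcoeffU1 fm1_eq1.
move=> /(_ _ hI) /= h.
have /eqP : (1 : FA)@_mone = 0.
  apply: h => f /= [|] ->.
    by rewrite expr2 rmorphM /= hx mul0r.
  by rewrite !rmorphB !rmorphM /= hx hy !mul0r mulr0 !subr0.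
by rewrite rmorph1 oner_eq0.
Qed.

HB.instance Definition _ := GRing.Zmodule_isNzRing.Build B
  sjp_mulA sjp_mul1 sjp_mulr1 sjp_mulDl sjp_mulDr sjp_oner_neq0.

Lemma sjp_scaleA c d (a : B) : sjp_scale c (sjp_scale d a) = sjp_scale (c * d) a.
Proof. by rewrite -[a]sjp_reprK -!sjp_projZ scalerA. Qed.

Lemma sjp_scale1 : left_id 1 sjp_scale.
Proof. by move=> a; rewrite -[a]sjp_reprK -sjp_projZ scale1r. Qed.

Lemma sjp_scaleDr : right_distributive sjp_scale +%R.
Proof.
move=> c a b; rewrite -[a]sjp_reprK -[b]sjp_reprK.
by rewrite -sjp_projD -!sjp_projZ scalerDr sjp_projD.
Qed.

Lemma sjp_scaleDl (a : B) : {morph sjp_scale^~ a : c d / c + d}.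
Proof.
by move=> c d; rewrite -[a]sjp_reprK -!sjp_projZ scalerDl sjp_projD.
Qed.

HB.instance Definition _ := GRing.Zmodule_isLmodule.Build k B
  sjp_scaleA sjp_scale1 sjp_scaleDr sjp_scaleDl.

Lemma sjp_scaleAl c (a b : B) : c *: (a * b) = c *: a * b.
Proof.
rewrite -[a]sjp_reprK -[b]sjp_reprK.
change (sjp_scale c (sjp_mul (sjp_proj (sjp_repr a)) (sjp_proj (sjp_repr b)))
  = sjp_mul (sjp_scale c (sjp_proj (sjp_repr a))) (sjp_proj (sjp_repr b))).
by rewrite -sjp_projZ -!sjp_projM -sjp_projZ scalerAl.
Qed.

HB.instance Definition _ := GRing.Lmodule_isLalgebra.Build k B sjp_scaleAl.

Lemma sjp_scaleAr c (a b : B) : c *: (a * b) = a * (c *: b).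
Proof.
rewrite -[a]sjp_reprK -[b]sjp_reprK.
change (sjp_scale c (sjp_mul (sjp_proj (sjp_repr a)) (sjp_proj (sjp_repr b)))
  = sjp_mul (sjp_proj (sjp_repr a)) (sjp_scale c (sjp_proj (sjp_repr b)))).
by rewrite -sjp_projZ -!sjp_projM -sjp_projZ free_scaleAr.
Qed.

HB.instance Definition _ := GRing.Lalgebra_isAlgebra.Build k B sjp_scaleAr.

Definition sjp_component (n : nat) : set B :=
  sjp_proj @` [set f | forall m : {fmonom bool}, m \in msupp f -> fdeg m = n].

Definition sjp_part (i : 'Z_2) : set B :=
  [set b | exists (N : nat) (h : nat -> B),
     (forall n, sjp_component n (h n)) /\
     b = \sum_(0 <= n < N | n%:R == i) h n].

End SuperJordanPlane.

(* -------------------------------------------------------------------- *)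
Section Fractions.
Context (R : pzRingType).
Implicit Types (A T : set R).

(* A is meant to be (the carrier of) a subring of R.  Since 1 is in A and
   R is nonzero, 0 is never regular.                                       *)
Definition regular_in A : set R :=
  [set a | [/\ A a, forall b, A b -> a * b = 0 -> b = 0
             & forall b, A b -> b * a = 0 -> b = 0]].

Definition right_ore T : Prop :=
  forall b s, T s -> exists b' s', T s' /\ b * s' = s * b'.

Definition left_ore T : Prop :=
  forall b s, T s -> exists b' s', T s' /\ s' * b = b' * s.

(* P is the ring of right fractions A T^-1 of the subring A at its
   multiplicative subset T, the canonical map A -> P being the restriction of
   iota : R -> Q.                                                          *)
Definition is_fraction_ring (Q : pzRingType) (iota : R -> Q) A T (P : set Q) :
    Prop :=
  [/\ forall t, T t -> exists u, [/\ P u, iota t * u = 1 & u * iota t = 1],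
      P = [set q | exists a t u,
             [/\ A a, T t, iota t * u = 1, u * iota t = 1 & q = iota a * u]]
    & forall a, A a -> (iota a = 0 <-> exists2 t, T t & a * t = 0)].

End Fractions.

(* -------------------------------------------------------------------- *)
Section Superalgebras.
Context (k : fieldType) (A : algType k).
Implicit Types (G : 'Z_2 -> set A) (I : set A).

Definition superalgebra_grading G : Prop :=
  [/\ forall i, G i 0 /\ (forall (c : k) a b, G i a -> G i b -> G i (c *: a + b)),
      forall a, exists a0 a1, [/\ G 0 a0, G 1 a1 & a = a0 + a1],
      forall a, G 0 a -> G 1 a -> a = 0,
      G 0 1
    & forall i j a b, G i a -> G j b -> G (i + j) (a * b)].

Definition graded_subset G I : Prop :=
  forall a0 a1, G 0 a0 -> G 1 a1 -> I (a0 + a1) -> I a0 /\ I a1.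

Definition super_simple G : Prop :=
  (exists a : A, a <> 0) /\
  forall I, twosided_ideal I -> graded_subset G I -> I = [set 0] \/ I = setT.

Definition dcc (C : set A -> Prop) : Prop :=
  forall I : nat -> set A, (forall n, C (I n)) ->
    (forall n, I n.+1 `<=` I n) ->
    exists N, forall n, (N <= n)%N -> I n = I N.

Definition super_artinian G : Prop :=
  dcc (fun I => left_ideal I /\ graded_subset G I) /\
  dcc (fun I => right_ideal I /\ graded_subset G I).

End Superalgebras.

(* Main.v *)
Require Import Defs.
From HB Require Import structures.
From mathcomp Require Import all_boot all_algebra.
From mathcomp Require Import boolp classical_sets.
From mathcomp Require Import finmap monalg.

Set Implicit Arguments.
Unset Strict Implicit.
Unset Printing Implicit Defensive.

Import GRing.Theory.
Local Open Scope classical_set_scope.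
Local Open Scope ring_scope.

(** The super Jordan plane B is an order in a ring of two by two matrices.  Let J
    be the Jordan plane, with generators s, w and relation w s = s w + s^2.  Then
    x |-> s E12 and y |-> w E12 + E21 respect the relations of B and send z to
    the scalar matrix s and y^2 to the scalar matrix w.  The basis x^a z^b y^c
    of B is mapped to independent matrices ([sjp_mx_inj]), the image contains
    the scalar matrices and s M_2(J) ([sjp_mx_scalar], [sjp_mx_lift]), and even
    elements are exactly the ones with a diagonal matrix, odd elements the ones with an
    antidiagonal matrix ([sjp_partP]).

    J is a domain, and pseudo-division by leading terms in w makes it left and
    right Ore ([jordan_left_ore], [jordan_right_ore]).  An even element is
    regular exactly when both entries of its diagonal are nonzero
    ([even_regularP]), so bringing four fractions over J to a common denominator
    proves the Ore conditions for the even regular elements of B.  An odd regular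
    element divides its square, which is even and regular; hence the Ore
    conditions for S, and the fact that even denominators suffice.

    A ring of fractions exists for every right Ore set of regular elements; it is
    built from germs of right linear maps ([ore_localization_exists]).

    If D is the division ring of fractions of J, then the ring of fractions of B
    is M_2(D), graded by diagonal and antidiagonal: its even part is D x D.
    For an arbitrary ring of fractions Q this structure is read off
    the idempotents e = (x y) z^-1 and f = (y x) z^-1.  They are central
    in the even part Q_0, each nonzero q e and q f with q in Q_0 is invertible in
    its block ([block_division]), and conjugation by y exchanges e and f.  Thus
    graded one-sided ideals are determined by whether they contain e and f, and
    a nonzero graded two-sided ideal contains both. *)

(** * One-sided Ore domains *)

Section OreDomains.
Variable A : nzRingType.

(** The right-hand version is this property of the converse ring. *)
Definition left_ore_domain : Prop :=
  (forall f g : A, f != 0 -> g != 0 -> f * g != 0) /\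
  (forall f g : A, g != 0 -> exists u v, u != 0 /\ u * f = v * g).

(** Euclid's algorithm: a division step c f - d g lowers the measure, and a
    common left multiple of the remainder and g yields one of f and g.  When f
    is the smaller one the two are exchanged, and the factor of g found for the
    exchanged pair is nonzero because there are no zero divisors. *)
Lemma pseudo_euclidean_left_ore (N : A -> nat) :
    (forall f g : A, f != 0 -> g != 0 -> f * g != 0) ->
    (forall f g : A, f != 0 -> g != 0 -> (N g <= N f)%N ->
       exists c d, c != 0 /\ (c * f = d * g \/ (N (c * f - d * g)%R < N f)%N)) ->
  left_ore_domain.
Proof.
move=> dom div; split=> // f g.
have [n] := ubnP (N f + N g); elim: n => // n IHn in f g *.
move=> + g0; have [-> _|f0] := eqVneq f 0.
  by exists 1, 0; rewrite oner_neq0 mulr0 mul0r.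
wlog leNgf : f g f0 g0 / (N g <= N f)%N => [wh le_n|le_n].
  have [le|/ltnW le] := leqP (N g) (N f); first exact: wh.
  have [|u [v [u0 uE]]] := wh _ _ g0 f0 le; first by rewrite addnC.
  exists v, u; split=> //.
  apply/eqP=> v0; move/eqP: uE; rewrite v0 mul0r; exact/negP/dom.
have [c [d [c0 [cE|ltN]]]] := div f g f0 g0 leNgf; first by exists c, d.
have [|u [v [u0 uE]]] := IHn (c * f - d * g) g _ g0.
  by apply: leq_trans (le_n : _ <= n)%N; rewrite ltn_add2r.
exists (u * c), (v + u * d); split; first exact: dom.
by rewrite mulrDl -uE mulrBr !mulrA subrK.
Qed.

(** Finitely many left fractions can be brought to one denominator; this is
    applied below to the four entries of a matrix. *)
Lemma common_denominator (s : seq (A * A)) : left_ore_domain ->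
    all (fun p => p.2 != 0) s ->
  exists2 u, u != 0 & forall p, p \in s -> exists v, u * p.1 = v * p.2.
Proof.
move=> [dom ore]; elim: s => [|[f g] s IHs] /=; first by exists 1; rewrite ?oner_neq0.
case/andP=> g0 /IHs[u u0 uE].
have [u' [v [u'0 u'E]]] := ore (u * f) g g0.
exists (u' * u); first exact: dom.
move=> p; rewrite inE => /predU1P[->|/uE[w wE]].
  by exists v; rewrite -mulrA.
by exists (u' * w); rewrite -!mulrA wE.
Qed.

End OreDomains.


(** * The Jordan plane as a ring of differential operators *)

Section JordanPlane.
Variable k : fieldType.
Local Notation R := {poly k}.
Local Notation P := {poly {poly k}}.
Implicit Types (c : R) (f g h : P).

(** The derivation s^2 d/ds of k[s]: the commutator of w with a polynomial in s,
    by the relation w s = s w + s^2. *)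
Definition jordan_der (c : R) : R := 'X ^+ 2 * c^`().
Local Notation delta := jordan_der.

Fact jordan_der_is_zmod_morphism : zmod_morphism delta.
Proof. by move=> c d; rewrite /delta derivB mulrBr. Qed.
HB.instance Definition _ :=
  GRing.isZmodMorphism.Build R R delta jordan_der_is_zmod_morphism.

Lemma jordan_derM c d : delta (c * d) = c * delta d + delta c * d.
Proof. by rewrite /delta derivM mulrDr addrC mulrCA [X in _ + X]mulrA. Qed.

(** An element of the Jordan plane is written with its coefficients in k[s] to
    the left of the powers of w, and [wmul] is then left multiplication by w,
    because w c = c w + delta(c) for c in k[s]. *)
Definition wmul g : P := 'X * g + map_poly delta g.

Fact wmul_is_zmod_morphism : zmod_morphism wmul.
Proof. by move=> f g; rewrite /wmul mulrBr raddfB opprD addrACA. Qed.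
HB.instance Definition _ := GRing.isZmodMorphism.Build P P wmul wmul_is_zmod_morphism.

Lemma wmulD : {morph wmul : f g / f + g}. Proof. exact: raddfD. Qed.

Lemma wmulZ c g : wmul (c *: g) = c *: wmul g + delta c *: g.
Proof.
apply/polyP=> i; rewrite /wmul !(coefD, coefZ, coefXM, coef_map) /= jordan_derM.
by case: i => [|i]; rewrite ?mulr0 ?mulrDr /= ?addrA ?coefZ ?mulr0.
Qed.

Lemma wmulXn i : wmul 'X^i = 'X^(i.+1).
Proof.
rewrite /wmul -exprS -[RHS]addr0; congr (_ + _); apply/polyP=> j.
rewrite coef_map coefXn coef0 /=; case: eqP => _; last by rewrite raddf0.
by rewrite /delta derivC mulr0.
Qed.

Lemma iter_wmul1 i : iter i wmul 1 = 'X^i.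
Proof. by elim: i => //= i ->; rewrite wmulXn. Qed.

Lemma iter_wmulD i f g : iter i wmul (f + g) = iter i wmul f + iter i wmul g.
Proof. by elim: i => //= i ->; rewrite raddfD. Qed.

(** A polynomial f in w acts as the differential operator with the same
    coefficients; multiplying is applying this operator, so associativity will
    come from the composition of operators. *)
Definition jmul f g : P := \sum_(i < size f) f`_i *: iter i wmul g.

Lemma jmulEw n f g : (size f <= n)%N ->
  jmul f g = \sum_(i < n) f`_i *: iter i wmul g.
Proof.
move=> le_fn; rewrite /jmul (big_ord_widen n (fun i => f`_i *: iter i wmul g)) //.
rewrite big_mkcond; apply: eq_bigr => i _; case: ltnP => // /leq_sizeP ->//.
by rewrite scale0r.
Qed.

Lemma jmulDl : left_distributive jmul +%R.
Proof.
move=> f g h; set n := maxn (size f) (size g).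
rewrite !(@jmulEw n) ?leq_maxl ?leq_maxr ?size_polyD //.
by rewrite -big_split; apply: eq_bigr => i _; rewrite coefD scalerDl.
Qed.

Lemma jmulDr : right_distributive jmul +%R.
Proof.
move=> f g h; rewrite -big_split; apply: eq_bigr => i _.
by rewrite iter_wmulD scalerDr.
Qed.

Lemma jmulZl c f g : jmul (c *: f) g = c *: jmul f g.
Proof.
rewrite (jmulEw _ (size_scale_leq c f)) scaler_sumr.
by apply: eq_bigr => i _; rewrite coefZ scalerA.
Qed.

Lemma jmulXnl i g : jmul 'X^i g = iter i wmul g.
Proof.
rewrite /jmul size_polyXn big_ord_recr /= coefXn eqxx scale1r big1 ?add0r //.
by move=> j _; rewrite coefXn ltn_eqF ?ltn_ord // scale0r.
Qed.

Lemma poly_monomial_ind (Q : P -> Prop) :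
  (forall c i, Q (c *: 'X^i)) -> (forall f g, Q f -> Q g -> Q (f + g)) ->
  forall f, Q f.
Proof.
move=> Qm QD f; rewrite -[f]coefK poly_def.
by elim/big_ind: _ => //; rewrite -(scale0r 'X^0).
Qed.

Lemma jmul_wmull f g : jmul (wmul f) g = wmul (jmul f g).
Proof.
elim/poly_monomial_ind: f => [c i|f1 f2 IH1 IH2]; last first.
  by rewrite wmulD (jmulDl (wmul f1)) IH1 IH2 (jmulDl f1) wmulD.
by rewrite wmulZ (jmulDl (c *: _)) !jmulZl wmulXn wmulZ !jmulXnl.
Qed.

Lemma jmulA : associative jmul.
Proof.
move=> f g h; elim/poly_monomial_ind: f => [c i|f1 f2 IH1 IH2]; last first.
  by rewrite !jmulDl IH1 IH2.
rewrite !jmulZl !jmulXnl; congr (_ *: _).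
by elim: i => //= i ->; rewrite jmul_wmull.
Qed.

Lemma jmul1l : left_id 1 jmul.
Proof. by move=> f; rewrite -[1](expr0 'X) jmulXnl. Qed.

Lemma jmul1r : right_id 1 jmul.
Proof.
move=> f; elim/poly_monomial_ind: f => [c i|f1 f2 IH1 IH2]; last first.
  by rewrite jmulDl IH1 IH2.
by rewrite jmulZl jmulXnl iter_wmul1.
Qed.

Definition jordan_plane := P.
HB.instance Definition _ := GRing.Zmodule.on jordan_plane.
HB.instance Definition _ := GRing.Zmodule_isNzRing.Build jordan_plane
  jmulA jmul1l jmul1r jmulDl jmulDr (oner_neq0 P).
Local Notation J := jordan_plane.

Lemma jordan_mulE (f g : J) : f * g = jmul f g. Proof. by []. Qed.

Definition jordan_s : J := ('X%:P : P).
Definition jordan_w : J := ('X : P).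

Lemma jordan_polyCM (c : R) (g : J) : (c%:P : J) * g = c *: (g : P) :> P.
Proof. by rewrite jordan_mulE -[_%:P]mulr1 mul_polyC jmulZl jmul1l. Qed.

Lemma jordan_wM (g : J) : jordan_w * g = wmul g :> P.
Proof. by rewrite jordan_mulE -[RHS](jmulXnl 1) expr1. Qed.

Lemma jordan_wXn i : jordan_w ^+ i = 'X^i :> P.
Proof. by elim: i => // i IHi; rewrite exprS jordan_wM IHi wmulXn. Qed.

Lemma jordan_ws : jordan_w * jordan_s = jordan_s * jordan_w + jordan_s * jordan_s.
Proof.
rewrite [LHS]jordan_wM [jordan_s * jordan_w]jordan_polyCM.
rewrite [jordan_s * jordan_s]jordan_polyCM /wmul map_polyC /=.
by rewrite /jordan_der derivX mulr1 expr2 -!mul_polyC mulrC polyCM.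
Qed.

Lemma jordan_constM (a b : k) :
  ((a * b)%:P%:P : J) = (a%:P%:P : J) * (b%:P%:P : J).
Proof. by rewrite [RHS]jordan_polyCM !polyCM mul_polyC. Qed.

Lemma jordan_constC (a : k) (f : J) : (a%:P%:P : J) * f = f * (a%:P%:P : J).
Proof.
rewrite jordan_polyCM [RHS]jordan_mulE.
elim/poly_monomial_ind: f => [c i|f g IHf IHg].
  rewrite jmulZl jmulXnl scalerA mulrC -scalerA; congr (_ *: _).
  elim: i => [|i] /=; first by rewrite alg_polyC.
  by move=> <-; rewrite wmulZ wmulXn /jordan_der derivC mulr0 scale0r addr0.
by rewrite (jmulDl f) scalerDr IHf IHg.
Qed.

(** The derivation leaves the w-degree alone, so for the top coefficient w
    commutes with k[s]. *)
Lemma iter_wmul_top i n g : (size g <= n.+1)%N ->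
  (size (iter i wmul g) <= (i + n).+1)%N /\ (iter i wmul g)`_(i + n) = g`_n.
Proof.
move=> le_g; elim: i => [|i [IHs IHc]] //=; rewrite addSn; split.
  apply: leq_trans (size_polyD _ _) _; rewrite geq_max.
  rewrite (leq_trans (size_polyMleq _ _)) ?size_polyX //=.
  exact: leq_trans (size_poly _ _) (leqW IHs).
rewrite /wmul coefD coefXM /= IHc coef_map /=.
by rewrite [X in delta X](_ : _ = 0) ?raddf0 ?addr0 //; move/leq_sizeP: IHs; apply.
Qed.

Lemma jmul_top m n f g : (size f <= m.+1)%N -> (size g <= n.+1)%N ->
  (size (jmul f g) <= (m + n).+1)%N /\ (jmul f g)`_(m + n) = f`_m * g`_n.
Proof.
move=> le_f le_g; rewrite (jmulEw _ le_f).
have top i := iter_wmul_top i le_g; split.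
  apply: (big_ind (fun h => size h <= (m + n).+1)%N); first by rewrite size_poly0.
    by move=> h1 h2 ? ?; rewrite (leq_trans (size_polyD _ _)) // geq_max; apply/andP.
  move=> i _; apply: leq_trans (size_scale_leq _ _) _.
  by apply: leq_trans (top i).1 _; rewrite ltnS leq_add2r -ltnS.
rewrite coef_sum big_ord_recr /= coefZ (top m).2 big1 ?add0r // => i _.
rewrite coefZ [X in _ * X](_ : _ = 0) ?mulr0 //.
by move/leq_sizeP: (top i).1; apply; rewrite -addSn leq_add2r.
Qed.

Lemma polynomial_size_predK f : f != 0 -> size f = (size f).-1.+1.
Proof. by rewrite -size_poly_gt0; case: (size f). Qed.

(** Leading coefficients are elements of the integral domain k[s]. *)
Lemma jordan_domain (f g : J) : f != 0 -> g != 0 -> f * g != 0.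
Proof.
move=> f0 g0; apply/eqP=> fg0.
have [|| _] := @jmul_top (size f).-1 (size g).-1 f g; rewrite -?polynomial_size_predK //.
rewrite -jordan_mulE fg0 coef0 => /esym/eqP; rewrite mulf_eq0.
by rewrite -!lead_coefE !lead_coef_eq0 (negPf f0) (negPf g0).
Qed.

Lemma size_cancel_top n (f g : P) : (size f <= n.+1)%N -> (size g <= n.+1)%N ->
  f`_n = g`_n -> (size (f - g)%R < n.+1)%N.
Proof.
move=> lef leg fg; rewrite ltnS; apply/leq_sizeP=> j.
rewrite leq_eqVlt => /predU1P[<-|lt]; first by rewrite coefB fg subrr.
have coef0_j h : (size h <= n.+1)%N -> h`_j = 0 by move/leq_sizeP; apply.
by rewrite coefB !coef0_j ?subr0.
Qed.

(** As leading coefficients multiply in the commutative ring k[s], a leading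
    term is cancelled by the same two factors on the left and on the right. *)
Lemma jordan_pseudo_division (f g : J) : f != 0 -> g != 0 ->
    (size (g : P) <= size (f : P))%N ->
  exists c d : J, [/\ c != 0, (size ((c * f - d * g)%R : P) < size (f : P))%N
                    & (size ((f * c - g * d)%R : P) < size (f : P))%N].
Proof.
move=> f0 g0 le_gf; pose e := (size (f : P) - size (g : P))%N.
pose c : P := (lead_coef (g : P))%:P; pose d : P := lead_coef (f : P) *: 'X^e.
exists c, d; rewrite (polynomial_size_predK f0).
have degE : (size (f : P)).-1 = (e + (size (g : P)).-1)%N.
  rewrite /e; move: le_gf g0; rewrite -size_poly_gt0; case: (size (g : P)) => // m.
  by case: (size (f : P)) => // n; rewrite ltnS subSS /= => le _; rewrite subnK.
have szg : (size (g : P) <= (size (g : P)).-1.+1)%N by rewrite -polynomial_size_predK.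
have szf : (size (f : P) <= (size (f : P)).-1.+1)%N by rewrite -polynomial_size_predK.
have szc : (size c <= 0.+1)%N by rewrite size_polyC_leq1.
have szd : (size d <= e.+1)%N.
  by rewrite (leq_trans (size_scale_leq _ _)) // size_polyXn.
have [c0E deE] : c`_0 = lead_coef (g : P) /\ d`_e = lead_coef (f : P).
  by rewrite coefC /= coefZ coefXn eqxx mulr1.
have [cf cfE] := jmul_top szc szf; have [dg dgE] := jmul_top szd szg.
have [fc fcE] := jmul_top szf szc; have [gd gdE] := jmul_top szg szd.
rewrite add0n in cf cfE; rewrite addn0 in fc fcE; rewrite addnC in gd gdE.
rewrite -degE in dg dgE gd gdE.
split; first by rewrite polyC_eq0 lead_coef_eq0.
  by apply: size_cancel_top => //; rewrite cfE dgE c0E deE -!lead_coefE mulrC.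
by apply: size_cancel_top => //; rewrite fcE gdE c0E deE -!lead_coefE mulrC.
Qed.

Lemma jordan_left_ore : left_ore_domain J.
Proof.
apply: (@pseudo_euclidean_left_ore _ (fun f : J => size (f : P))).
  exact: jordan_domain.
move=> f g f0 g0 le_gf; have [c [d [c0 lt _]]] := jordan_pseudo_division f0 g0 le_gf.
by exists c, d; split=> //; right.
Qed.

Lemma jordan_right_ore : left_ore_domain J^c.
Proof.
apply: (@pseudo_euclidean_left_ore J^c (fun f : J^c => size (f : P))).
  by move=> f g f0 g0; apply: jordan_domain.
move=> f g f0 g0 le_gf; have [c [d [c0 _ lt]]] := jordan_pseudo_division f0 g0 le_gf.
by exists c, d; split=> //; right.
Qed.
End JordanPlane.

(** * Normal forms from the relations *)

Section SuperJordanRelations.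
Variables (k : fieldType) (A : algType k) (x y z : A).
Hypotheses (rel_z : z = x * y + y * x) (rel_xx : x * x = 0).
Hypothesis (rel_yz : y * z = z * y + x * z).
Local Notation J := (jordan_plane k).
Local Notation P := {poly {poly k}}.

Lemma sjp_zx : z * x = x * z.
Proof.
rewrite rel_z mulrDl mulrDr !mulrA rel_xx mul0r add0r.
by rewrite -[y * x * x]mulrA rel_xx mulr0 addr0.
Qed.

Lemma sjp_yx : y * x = z - x * y.
Proof. by rewrite rel_z addrC addKr. Qed.

Local Notation Y := (y * y).

Local Notation ev_z := (horner_alg z).

Lemma ev_zC a (b : A) : ev_z a%:P * b = b * ev_z a%:P.
Proof. by rewrite horner_algC mulr_algl mulr_algr. Qed.

Lemma ev_z_x (c : {poly k}) : ev_z c * x = x * ev_z c.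
Proof.
elim/poly_ind: c => [|c a IHc]; first by rewrite rmorph0 mul0r mulr0.
rewrite rmorphD rmorphM /= horner_algX mulrDl mulrDr ev_zC; congr (_ + _).
by rewrite -mulrA sjp_zx !mulrA IHc.
Qed.

(** Moving y past z costs x z, and x commutes with z; moving y past a polynomial
    c in z therefore costs x z c'(z). *)
Lemma sjp_y_ev_z c : y * ev_z c = ev_z c * y + x * ev_z ('X * c^`()).
Proof.
elim/poly_ind: c => [|c a IHc]; first by rewrite deriv0 !(mulr0, rmorph0) mul0r addr0.
rewrite derivD derivC addr0 derivM derivX mulr1 mulrDr !rmorphD !rmorphM /= horner_algX.
rewrite !mulrDr !mulrDl -!ev_zC.
rewrite [y * _]mulrA IHc mulrDl -!mulrA rel_yz rmorphM /= horner_algX.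
rewrite mulrDr [ev_z c * (x * z)]mulrA ev_z_x -!mulrA.
have zc : ev_z 'X * ev_z c = ev_z c * ev_z 'X by rewrite -!rmorphM mulrC.
rewrite /= !horner_algX in zc.
by rewrite zc -!addrA; congr (_ + _); rewrite [RHS]addrC [X in _ = X + _]addrC -!addrA.
Qed.

(** Applying the previous rule twice, and x x = 0, shows that y^2 and z satisfy
    the relation of w and s in the Jordan plane. *)
Lemma sjp_Y_ev_z c : Y * ev_z c = ev_z c * Y + ev_z (jordan_der c).
Proof.
rewrite -mulrA sjp_y_ev_z mulrDr [y * (ev_z c * y)]mulrA sjp_y_ev_z mulrDl.
rewrite [y * (x * _)]mulrA sjp_yx mulrBl -!mulrA -addrA; congr (_ + _).
rewrite sjp_y_ev_z !mulrDr [x * (x * _)]mulrA rel_xx mul0r addr0.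
rewrite addrC subrK /jordan_der expr2 -!mulrA [in RHS]rmorphM /=.
by rewrite horner_algX.
Qed.

(** The substitution of z for s and of y^2 for w, with the powers of z to the
    left as in the normal form of the Jordan plane. *)
Definition ev (f : P) : A := (map_poly ev_z f).[Y].

Fact ev_is_zmod_morphism : zmod_morphism ev.
Proof. by move=> f g; rewrite /ev raddfB hornerD hornerN. Qed.
HB.instance Definition _ := GRing.isZmodMorphism.Build P A ev ev_is_zmod_morphism.

Lemma evD : {morph ev : f g / f + g}. Proof. exact: raddfD. Qed.

Lemma evB : {morph ev : f g / f - g}. Proof. exact: raddfB. Qed.

Lemma evZ c f : ev (c *: f) = ev_z c * ev f.
Proof. by rewrite /ev map_polyZ hornerZ. Qed.

Lemma evXn i : ev 'X^i = Y ^+ i.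
Proof. by rewrite /ev map_polyXn hornerXn. Qed.

Lemma ev1 : ev 1 = 1.
Proof. by rewrite -(expr0 'X) evXn. Qed.

Lemma ev_wmul f : ev (wmul f) = Y * ev f.
Proof.
elim/poly_monomial_ind: f => [c i|f g IHf IHg]; last first.
  by rewrite wmulD (evD (wmul f)) (evD f) mulrDr IHf IHg.
rewrite wmulZ wmulXn evD !evZ !evXn [RHS]mulrA sjp_Y_ev_z mulrDl.
by rewrite exprS !mulrA.
Qed.

Lemma evM (f g : J) : ev (f * g) = ev f * ev g.
Proof.
rewrite jordan_mulE; elim/poly_monomial_ind: f => [c i|f1 f2 IH1 IH2].
  rewrite jmulZl jmulXnl !evZ evXn -mulrA; congr (_ * _).
  by elim: i => [|i IHi] /=; rewrite ?mul1r // ev_wmul IHi exprS -!mulrA.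
by rewrite (jmulDl f1) (evD (jmul f1 g)) (evD f1) mulrDl IH1 IH2.
Qed.

Lemma sjp_y_ev f : exists h, y * ev f = ev f * y + x * ev h.
Proof.
elim/poly_monomial_ind: f => [c i|f g [hf fE] [hg gE]].
  exists (('X * c^`()) *: 'X^i); rewrite !evZ evXn mulrA sjp_y_ev_z mulrDl -!mulrA.
  by congr (_ * _ + _); rewrite -[y * _]/(y * Y ^+ i) -expr2 -exprM -exprS -exprSr.
by exists (hf + hg); rewrite !evD !(mulrDl, mulrDr) fE gE addrACA.
Qed.

Local Notation s := (jordan_s k).
Local Notation w := (jordan_w k).

Lemma ev_s : ev s = z.
Proof. by rewrite /jordan_s -[_%:P]mulr1 mul_polyC evZ ev1 mulr1 horner_algX. Qed.

Lemma ev_w : ev w = Y.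
Proof. by rewrite -[RHS]expr1 -evXn expr1. Qed.

(** The normal form given by the basis x^a z^b y^c, grouped by a and by the
    parity of c. *)
Definition sjp_nf (f g h r : J) : A :=
  ev f + x * ev g * y + x * ev h + ev r * y.

Lemma sjp_nfD f1 g1 h1 r1 f2 g2 h2 r2 :
  sjp_nf (f1 + f2) (g1 + g2) (h1 + h2) (r1 + r2) =
  sjp_nf f1 g1 h1 r1 + sjp_nf f2 g2 h2 r2.
Proof.
rewrite /sjp_nf !evD !(mulrDl, mulrDr) [RHS]addrACA; congr (_ + _).
by rewrite [RHS]addrACA; congr (_ + _); rewrite [RHS]addrACA.
Qed.

Lemma sjp_nfZ c (f g h r : P) :
  sjp_nf (c%:P *: f) (c%:P *: g) (c%:P *: h) (c%:P *: r) = c *: sjp_nf f g h r.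
Proof.
rewrite /sjp_nf !evZ !horner_algC !mulr_algl -!scalerAr -!scalerAl.
by rewrite -!scalerDr.
Qed.

Lemma sjp_nf_const c : sjp_nf c%:P%:P 0 0 0 = c%:A.
Proof.
rewrite /sjp_nf !raddf0 !(mulr0, mul0r, addr0) -[c%:P%:P]mulr1 mul_polyC evZ.
by rewrite ev1 mulr1 horner_algC.
Qed.

Lemma sjp_x_nf f g h r : x * sjp_nf f g h r = sjp_nf 0 r f 0.
Proof.
rewrite /sjp_nf !mulrDr !mulrA rel_xx !mul0r !addr0 raddf0 mul0r addr0 add0r.
by rewrite addrC.
Qed.

(** Normal forms are stable under left multiplication by y, since y x = z - x y
    and y passes a polynomial in z and y^2 up to a multiple of x. *)
Lemma sjp_y_nf f g h r : exists h0 h1,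
  y * sjp_nf f g h r =
  sjp_nf (s * h + r * w) (h1 - h) (h0 - g * w)
    (f + s * g).
Proof.
have [h0 fE] := sjp_y_ev f; have [h1 rE] := sjp_y_ev r.
have yxE (p : J) : y * (x * ev p) = ev (s * p) - x * ev p * y.
  have [h' pE] := sjp_y_ev p.
  rewrite mulrA sjp_yx mulrBl -[x * y * _]mulrA pE mulrDr !mulrA rel_xx mul0r addr0.
  by rewrite evM ev_s.
exists h0, h1; rewrite /sjp_nf.
rewrite (evD (s * h)) (evB h1) (evB h0) (evD f) !evM ev_w.
rewrite 3!mulrDr [y * (ev r * y)]mulrA rE fE [y * (x * _ * y)]mulrA !yxE !evM.
rewrite !mulrBr !(mulrDl, mulrBl) ?mulNr !mulrA.
by rewrite [LHS](AC (2*2*2*2) ((5*7)*(8*6)*(2*4)*(1*3))).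
Qed.

End SuperJordanRelations.

(** * Two by two matrices over a ring *)

Section TwoByTwo.
Variable R : nzRingType.

Definition mx2 (a b c d : R) : 'M[R]_2 :=
  \matrix_(i, j) if i == 0 then (if j == 0 then a else b)
                 else (if j == 0 then c else d).

Lemma ord2_cases (i : 'I_2) : i = 0 \/ i = 1.
Proof. by case: i => [[|[|]]] // ?; [left|right]; apply: val_inj. Qed.

Lemma mx2E (M : 'M[R]_2) : M = mx2 (M 0 0) (M 0 1) (M 1 0) (M 1 1).
Proof.
apply/matrixP=> i j; rewrite mxE.
by have [->|->] := ord2_cases i; have [->|->] := ord2_cases j.
Qed.

Lemma mx2M a b c d a' b' c' d' :
  mx2 a b c d * mx2 a' b' c' d' =
  mx2 (a * a' + b * c') (a * b' + b * d') (c * a' + d * c') (c * b' + d * d').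
Proof.
rewrite [LHS]mx2E; congr mx2;
  by rewrite !mxE big_ord_recl big_ord1 !mxE.
Qed.

Lemma mx2D a b c d a' b' c' d' :
  mx2 a b c d + mx2 a' b' c' d' = mx2 (a + a') (b + b') (c + c') (d + d').
Proof. by rewrite [LHS]mx2E; congr mx2; rewrite !mxE. Qed.

Lemma mx2_scalar (a : R) : a%:M = mx2 a 0 0 a.
Proof. by rewrite [LHS]mx2E; congr mx2; rewrite !mxE. Qed.


Lemma mx2_0 : mx2 0 0 0 0 = 0.
Proof. by rewrite -mx2_scalar raddf0. Qed.

Lemma mx2_eq0 a b c d : mx2 a b c d = 0 -> [/\ a = 0, b = 0, c = 0 & d = 0].
Proof.
move=> M0; have M0E i j := congr1 (fun M : 'M_2 => M i j) M0.
by have := (M0E 0 0, M0E 0 1, M0E 1 0, M0E 1 1); rewrite !mxE /= => -[[[]]].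
Qed.

Lemma central_scalar_mxC (a : R) (M : 'M[R]_2) : (forall b, a * b = b * a) ->
  a%:M * M = M * a%:M.
Proof.
move=> aC; rewrite [M]mx2E mx2_scalar !mx2M !(mul0r, mulr0, addr0, add0r).
by rewrite !aC.
Qed.

(** Over a ring with w s = s w + s^2, the matrices s E12 and w E12 + E21 satisfy
    the relations of x and y; z becomes the scalar matrix s. *)
Section Generators.
Variables (s w : R).
Hypothesis ws : w * s = s * w + s * s.
Let X := mx2 0 s 0 0.
Let Y := mx2 0 w 1 0.

Lemma gen_mx_xx : X * X = 0.
Proof. by rewrite mx2M !(mul0r, mulr0, addr0) mx2_0. Qed.

Lemma gen_mx_z : X * Y + Y * X = s%:M.
Proof.
by rewrite !mx2M mx2D mx2_scalar !(mulr0, mul0r, addr0, add0r, mulr1, mul1r).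
Qed.

Lemma gen_mx_yz : Y * s%:M - s%:M * Y - X * s%:M = 0.
Proof.
apply/eqP; rewrite -addrA -opprD subr_eq0 mx2_scalar !mx2M mx2D.
by rewrite !(mulr0, mul0r, addr0, add0r, mulr1, mul1r) ws.
Qed.
End Generators.
End TwoByTwo.

(** * The matrix representation of the super Jordan plane *)

Section MatrixModel.
Variable k : fieldType.
Local Notation J := (jordan_plane k).
Local Notation FA := {malg k[{fmonom bool}]}.
Local Notation B := (super_jordan_plane k).
Local Notation P := {poly {poly k}}.
Local Notation s := (jordan_s k : J).
Local Notation w := (jordan_w k : J).

Definition gen_mx (i : bool) : 'M[J]_2 := if i then mx2 0 w 1 0 else mx2 0 s 0 0.

Definition word_mx (m : {fmonom bool}) : 'M[J]_2 := \prod_(i <- m) gen_mx i.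

Fact word_mx_is_mmorphism : mmorphism word_mx.
Proof.
split=> [m n|]; rewrite /word_mx; first by rewrite fmM big_cat.
by rewrite fm1 big_nil.
Qed.
HB.instance Definition _ :=
  monalg.isMultiplicative.Build {fmonom bool} 'M[J]_2 word_mx word_mx_is_mmorphism.

Definition const_scalar_mx (a : k) : 'M[J]_2 := (a%:P%:P : J)%:M.

Fact const_scalar_mx_is_zmod_morphism : zmod_morphism const_scalar_mx.
Proof. by move=> a b; rewrite /const_scalar_mx !polyCB; apply: (raddfB (@scalar_mx J 2)). Qed.
HB.instance Definition _ := GRing.isZmodMorphism.Build k 'M[J]_2 const_scalar_mx
  const_scalar_mx_is_zmod_morphism.

Fact const_scalar_mx_is_monoid_morphism : monoid_morphism const_scalar_mx.
Proof.
by split=> // a b; rewrite /const_scalar_mx jordan_constM scalar_mxM.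
Qed.
HB.instance Definition _ := GRing.isMonoidMorphism.Build k 'M[J]_2 const_scalar_mx
  const_scalar_mx_is_monoid_morphism.

Lemma const_scalar_mxC a M : const_scalar_mx a * M = M * const_scalar_mx a.
Proof. exact/central_scalar_mxC/jordan_constC. Qed.

Definition free_mx : FA -> 'M[J]_2 := mmap const_scalar_mx word_mx.

Lemma free_mxD : {morph free_mx : f g / f + g}. Proof. exact: mmapD. Qed.
Lemma free_mxB : {morph free_mx : f g / f - g}. Proof. exact: mmapB. Qed.
Lemma free_mx0 : free_mx 0 = 0. Proof. exact: mmap0. Qed.

Lemma free_mxM : {morph free_mx : f g / f * g}.
Proof.
suff [] : multiplicative free_mx by [].
apply: commr_mmap_is_multiplicative => g m m'; exact: const_scalar_mxC.
Qed.
Lemma free_mx1 : free_mx 1 = 1. Proof. exact: mmap1. Qed.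

Lemma free_mxZ a f : free_mx (a *: f) = const_scalar_mx a * free_mx f.
Proof. exact: mmapZ. Qed.

Lemma free_mx_gen i : free_mx << fmu i >> = gen_mx i.
Proof. by rewrite /free_mx mmapU /= rmorph1 mul1r /word_mx fmU big_seq1. Qed.

Lemma free_mx_x : free_mx (free_x k) = mx2 0 s 0 0. Proof. exact: free_mx_gen. Qed.
Lemma free_mx_y : free_mx (free_y k) = mx2 0 w 1 0. Proof. exact: free_mx_gen. Qed.

Lemma free_mx_z : free_mx (free_z k) = s%:M.
Proof.
rewrite -(gen_mx_z s w) -free_mx_x -free_mx_y /free_z.
by rewrite free_mxD; congr (_ + _); exact: free_mxM.
Qed.

Lemma free_mx_relator f : @sjp_relators k f -> free_mx f = 0.
Proof.
case=> /= ->.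
  rewrite -(gen_mx_xx s) -free_mx_x.
  exact: free_mxM.
rewrite -(gen_mx_yz (jordan_ws k)) -free_mx_x -free_mx_y -free_mx_z.
by rewrite !free_mxB; congr (_ - _ - _); exact: free_mxM.
Qed.

Lemma free_mx_ideal f : sjp_ideal f -> free_mx f = 0.
Proof.
move/asboolP=> /(_ [set f | free_mx f = 0]) /=; apply; last exact: free_mx_relator.
split; split=> [|f1 f2 /= f10 f20|f1 f2 /= f20]; first exact: free_mx0.
- by rewrite (free_mxD f1) f10 f20 addr0.
- by rewrite (free_mxM f1) f20 mulr0.
- exact: free_mx0.
- by rewrite (free_mxD f1) f10 f20 addr0.
- by rewrite (free_mxM f2) f20 mul0r.
Qed.

Definition sjp_mx (b : B) : 'M[J]_2 := free_mx (sjp_repr b).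

Lemma sjp_mx_proj f : sjp_mx (sjp_proj f) = free_mx f.
Proof.
by apply/eqP; rewrite -subr_eq0 -free_mxB; apply/eqP/free_mx_ideal/sjp_projK.
Qed.

Lemma sjp_mxZ a b : sjp_mx (a *: b) = const_scalar_mx a * sjp_mx b.
Proof. by rewrite -[a *: b]/(sjp_proj _) sjp_mx_proj free_mxZ. Qed.

Fact sjp_mx_is_zmod_morphism : zmod_morphism sjp_mx.
Proof.
move=> a b; rewrite -{1}[a]sjp_reprK -{1}[b]sjp_reprK.
suff -> : sjp_proj (sjp_repr a) - sjp_proj (sjp_repr b) =
          sjp_proj (sjp_repr a - sjp_repr b) :> B by rewrite sjp_mx_proj free_mxB.
by apply: (addIr (sjp_proj (sjp_repr b))); rewrite -sjp_projD !subrK.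
Qed.
HB.instance Definition _ := GRing.isZmodMorphism.Build B 'M[J]_2 sjp_mx
  sjp_mx_is_zmod_morphism.

Fact sjp_mx_is_monoid_morphism : monoid_morphism sjp_mx.
Proof.
split=> [|a b]; first by rewrite -[1]/(sjp_proj 1) sjp_mx_proj free_mx1.
by rewrite -[a * b]/(sjp_proj _) sjp_mx_proj free_mxM.
Qed.
HB.instance Definition _ := GRing.isMonoidMorphism.Build B 'M[J]_2 sjp_mx
  sjp_mx_is_monoid_morphism.
End MatrixModel.

(** * The matrices of normal forms *)

Section NormalFormMatrix.
Variable k : fieldType.
Local Notation J := (jordan_plane k).
Local Notation P := {poly {poly k}}.
Local Notation s := (jordan_s k : J).
Local Notation w := (jordan_w k : J).

Variables (A : algType k) (x y z : A) (psi : {rmorphism A -> 'M[J]_2}).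
Hypotheses (psix : psi x = mx2 0 s 0 0) (psiy : psi y = mx2 0 w 1 0).
Hypotheses (psiz : psi z = s%:M).
Hypothesis (psiA : forall c, psi c%:A = (c%:P%:P : J)%:M).

Let scD (f g : J) : (f + g)%:M = f%:M + g%:M :> 'M[J]_2.
Proof. exact: raddfD. Qed.

Let scM (f g : J) : (f * g)%:M = f%:M * g%:M :> 'M[J]_2.
Proof. exact: scalar_mxM. Qed.

Lemma mx_ev_z (c : {poly k}) : psi (horner_alg z c) = (c%:P : J)%:M.
Proof.
elim/poly_ind: c => [|c a IHc]; first by rewrite !raddf0.
rewrite rmorphD rmorphD rmorphM rmorphM /= horner_algC psiA horner_algX IHc psiz.
by rewrite -scM -scD jordan_polyCM /jordan_s polyCD polyCM mul_polyC.
Qed.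

Lemma mx_ev (f : J) : psi (ev y z f) = f%:M.
Proof.
elim/poly_monomial_ind: f => [c i|f g IHf IHg]; last first.
  by rewrite evD rmorphD [LHS]/= IHf IHg -scD.
rewrite evZ evXn rmorphM rmorphXn rmorphM /= mx_ev_z psiy.
have -> : mx2 0 w 1 0 * mx2 0 w 1 0 = w%:M.
  by rewrite mx2M mx2_scalar !(mulr0, mul0r, addr0, add0r, mulr1, mul1r).
have -> : (w%:M : 'M[J]_2) ^+ i = (w ^+ i)%:M by rewrite -rmorphXn.
by rewrite -scM jordan_polyCM jordan_wXn.
Qed.

Lemma mx_nf f g h r :
  psi (sjp_nf x y z f g h r) = mx2 (f + s * g) (s * h + r * w) r f.
Proof.
rewrite /sjp_nf !rmorphD !rmorphM /= !mx_ev psix psiy.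
move: s w => s' w'.
rewrite !mx2_scalar !mx2M !mx2D.
by rewrite !(mulr0, mul0r, addr0, add0r, mulr1, mul1r).
Qed.

(** The second row of the matrix determines r and f; the first one then
    determines g and h, because the Jordan plane has no zero divisors. *)
Lemma mx_nf_inj f g h r : psi (sjp_nf x y z f g h r) = 0 -> sjp_nf x y z f g h r = 0.
Proof.
have s0 : s != 0 by rewrite polyC_eq0 polyX_eq0.
rewrite mx_nf => M0.
have r0 : r = 0 by have := congr1 (fun M : 'M_2 => M 1 0) M0; rewrite !mxE.
have f0 : f = 0 by have := congr1 (fun M : 'M_2 => M 1 1) M0; rewrite !mxE.
have g0 : g = 0.
  have := congr1 (fun M : 'M_2 => M 0 0) M0; rewrite !mxE /= f0 add0r => /eqP.
  by apply: contraTeq => g0; apply: jordan_domain.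
have h0 : h = 0.
  have := congr1 (fun M : 'M_2 => M 0 1) M0; rewrite !mxE /= r0 mul0r addr0 => /eqP.
  by apply: contraTeq => h0; apply: jordan_domain.
by rewrite r0 f0 g0 h0 /sjp_nf !raddf0 !(mulr0, mul0r, addr0).
Qed.

(** The image contains the multiples by s of all matrices, so it has the same
    fractions as the full matrix ring. *)
Lemma mx_nf_lift (M : 'M[J]_2) :
  psi (sjp_nf x y z (s * M 1 1) (M 0 0 - M 1 1) (M 0 1 - M 1 0 * w) (s * M 1 0))
  = s%:M * M.
Proof.
rewrite mx_nf [in RHS](mx2E M) mx2_scalar mx2M.
move: s w => s' w'.
by rewrite !(mul0r, addr0, add0r) !mulrBr !mulrA addrC !subrK.
Qed.

End NormalFormMatrix.

(** * The parity of a matrix *)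

Section MatrixGrading.
Variable R : nzRingType.

(** Parity 0 is the diagonal and parity 1 the antidiagonal; adding parities as
    indices in Z/2 makes multiplicativity uniform. *)
Definition mx_deg (i : 'Z_2) (M : 'M[R]_2) : Prop :=
  forall a b : 'Z_2, b != a + i -> M a b = 0.

Lemma mx_deg0 i : mx_deg i 0.
Proof. by move=> a b _; rewrite mxE. Qed.

Lemma mx_degD i M N : mx_deg i M -> mx_deg i N -> mx_deg i (M + N).
Proof. by move=> dM dN a b ab; rewrite mxE dM ?dN ?addr0. Qed.

Lemma mx_degM i j M N : mx_deg i M -> mx_deg j N -> mx_deg (i + j) (M * N).
Proof.
move=> dM dN a b ab; rewrite mxE big1 // => c _.
have [cE|cN] := eqVneq c (a + i); last by rewrite dM ?mul0r.
by rewrite dN ?mulr0 // cE -addrA.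
Qed.

Lemma mx_deg_scalar (r : R) : mx_deg 0 r%:M.
Proof. by move=> a b; rewrite addr0 mxE eq_sym => /negPf->. Qed.

Lemma mx_deg1 : mx_deg 0 1. Proof. exact: mx_deg_scalar. Qed.

Lemma mx_deg_diag p q : mx_deg 0 (mx2 p 0 0 q).
Proof.
by move=> a b; rewrite addr0 mxE;
  have [->|->] := ord2_cases a; have [->|->] := ord2_cases b.
Qed.

Lemma mx_deg_anti p q : mx_deg 1 (mx2 0 p q 0).
Proof.
by move=> a b; rewrite mxE;
  have [->|->] := ord2_cases a; have [->|->] := ord2_cases b.
Qed.

Lemma mx_deg0E M : mx_deg 0 M -> M = mx2 (M 0 0) 0 0 (M 1 1).
Proof. by move=> dM; rewrite [LHS]mx2E (dM 0 1) ?(dM 1 0). Qed.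

Lemma mx_deg1E M : mx_deg 1 M -> M = mx2 0 (M 0 1) (M 1 0) 0.
Proof. by move=> dM; rewrite [LHS]mx2E (dM 0 0) ?(dM 1 1). Qed.

Lemma mx_deg_disjoint M : mx_deg 0 M -> mx_deg 1 M -> M = 0.
Proof.
move=> d0 /mx_deg1E ->; apply/matrixP=> a b; rewrite mxE.
by rewrite (d0 0 1) ?(d0 1 0) //; case: ifP; case: ifP; rewrite !mxE.
Qed.

End MatrixGrading.

(** * Faithfulness and parity of the representation *)

Section SuperJordanPlaneMatrices.
Variable k : fieldType.
Local Notation J := (jordan_plane k).
Local Notation FA := {malg k[{fmonom bool}]}.
Local Notation B := (super_jordan_plane k).
Local Notation P := {poly {poly k}}.
Local Notation s := (jordan_s k : J).
Local Notation w := (jordan_w k : J).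
Local Notation x := (sjp_proj (free_x k) : B).
Local Notation y := (sjp_proj (free_y k) : B).
Local Notation z := (sjp_proj (free_z k) : B).
Local Notation phi := (@sjp_mx k).

Lemma sjp_proj_mul (f g : FA) : sjp_proj (f * g) = sjp_proj f * sjp_proj g.
Proof. exact: sjp_projM. Qed.

Lemma sjp_proj_mul_add (f g f' g' : FA) :
  sjp_proj (f * g + f' * g') = sjp_proj f * sjp_proj g + sjp_proj f' * sjp_proj g'.
Proof.
exact: (etrans (sjp_projD _ _) (congr2 +%R (sjp_proj_mul f g) (sjp_proj_mul f' g'))).
Qed.

Lemma sjp_projB (f g : FA) : sjp_proj (f - g) = sjp_proj f - sjp_proj g.
Proof. by apply: (addIr (sjp_proj g)); rewrite -sjp_projD !subrK. Qed.

Lemma sjp_proj_relator (f : FA) : @sjp_relators k f -> sjp_proj f = 0.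
Proof.
move=> rf; rewrite -sjp_proj0; apply/sjp_projE; rewrite subr0.
by apply/asboolP=> I _; apply.
Qed.

Lemma sjp_xx : x * x = 0.
Proof.
by rewrite -[LHS]sjp_proj_mul; apply: sjp_proj_relator; left.
Qed.

Lemma sjp_zE : z = x * y + y * x.
Proof. exact: sjp_proj_mul_add. Qed.

Lemma sjp_yz : y * z = z * y + x * z.
Proof.
have /sjp_proj_relator : sjp_relators
    (free_y k * free_z k - free_z k * free_y k - free_x k * free_z k).
  by right.
move/eqP; rewrite !sjp_projB -addrA -opprD subr_eq0 => /eqP yzE.
apply: (etrans (esym (sjp_proj_mul (free_y k) (free_z k)))); apply: (etrans yzE).
exact: (congr2 (fun a b : B => a + b) (sjp_proj_mul (free_z k) (free_y k))
  (sjp_proj_mul (free_x k) (free_z k))).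
Qed.

Lemma malgU_scale (c : k) (m : {fmonom bool}) : << c *g m >> = c *: << m >> :> FA.
Proof. by apply/malgP=> m'; rewrite mcoeffZ (mcoeffU m c) (mcoeffU m 1) mulr_natr. Qed.

Lemma malgU_cons i t :
  << FMonom (i :: t) >> = << fmu i >> * << FMonom t >> :> FA.
Proof.
rewrite malgM_def fgmulUU mulr1; congr << _ >>.
by apply/eqP; rewrite fmP fmM fmU.
Qed.

(** The algebra is spanned by the words in its two generators. *)
Lemma sjp_ind (Q : B -> Prop) :
  Q 0 -> (forall a b, Q a -> Q b -> Q (a + b)) -> (forall c b, Q b -> Q (c *: b)) ->
  Q 1 -> (forall b, Q b -> Q (x * b)) -> (forall b, Q b -> Q (y * b)) ->
  forall b, Q b.
Proof.
move=> Q0 QD QZ Q1 Qx Qy b; rewrite -[b]sjp_reprK [sjp_repr b]monalgE.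
apply: (big_ind (fun f => Q (sjp_proj f))); first by rewrite sjp_proj0.
  by move=> f g ? ?; rewrite sjp_projD; apply: QD.
move=> m _; rewrite malgU_scale sjp_projZ; apply: QZ.
case: m => t; elim: t => [|i t IHt].
  suff -> : << FMonom [::] >> = 1 :> FA by [].
  by rewrite -fmoneE.
by rewrite malgU_cons sjp_proj_mul; case: i; [apply: Qy|apply: Qx].
Qed.

Local Notation nf := (@sjp_nf k B x y z).

Lemma sjp_span b : exists f g h r, b = nf f g h r.
Proof.
elim/sjp_ind: b.
- exists (0%:P%:P : P), 0, 0, 0; apply: esym.
  exact: etrans (sjp_nf_const _ _ _ _) (scale0r _).
- move=> _ _ [f1 [g1 [h1 [r1 ->]]]] [f2 [g2 [h2 [r2 ->]]]].
  by exists (f1 + f2), (g1 + g2), (h1 + h2), (r1 + r2); rewrite sjp_nfD.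
- move=> c _ [f [g [h [r ->]]]].
  exists (c%:P *: (f : P)), (c%:P *: (g : P)), (c%:P *: (h : P)), (c%:P *: (r : P)).
  exact/esym/sjp_nfZ.
- exists (1%:P%:P : P), 0, 0, 0; apply: esym.
  exact: etrans (sjp_nf_const _ _ _ _) (scale1r _).
- move=> _ [f [g [h [r ->]]]]; exists 0, r, f, 0.
  exact: (sjp_x_nf _ _ sjp_xx).
- move=> _ [f [g [h [r ->]]]].
  have [h0 [h1 E]] := sjp_y_nf sjp_zE sjp_xx sjp_yz f g h r.
  by exists (s * h + r * w), (h1 - h), (h0 - g * w), (f + s * g).
Qed.

Lemma sjp_mx_x : phi x = mx2 0 s 0 0.
Proof. by rewrite sjp_mx_proj free_mx_x. Qed.
Lemma sjp_mx_y : phi y = mx2 0 w 1 0.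
Proof. by rewrite sjp_mx_proj free_mx_y. Qed.
Lemma sjp_mx_z : phi z = s%:M.
Proof. by rewrite sjp_mx_proj free_mx_z. Qed.
Lemma sjp_mx_alg c : phi c%:A = (c%:P%:P : J)%:M.
Proof. by rewrite sjp_mxZ rmorph1 mulr1. Qed.

Lemma sjp_mx_inj : injective phi.
Proof.
apply: raddf_inj => b; have [f [g [h [r ->]]]] := sjp_span b.
exact: (mx_nf_inj sjp_mx_x sjp_mx_y sjp_mx_z sjp_mx_alg).
Qed.

Lemma sjp_mx_scalar (f : J) : exists b, phi b = f%:M.
Proof. exists (ev y z f); exact: (mx_ev sjp_mx_y sjp_mx_z sjp_mx_alg). Qed.

Lemma sjp_mx_lift (M : 'M[J]_2) : exists b, phi b = s%:M * M.
Proof.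
exists (nf (s * M 1 1) (M 0 0 - M 1 1) (M 0 1 - M 1 0 * w) (s * M 1 0)).
exact: (mx_nf_lift sjp_mx_x sjp_mx_y sjp_mx_z sjp_mx_alg).
Qed.

Lemma word_mx_deg (m : {fmonom bool}) : mx_deg (fdeg m)%:R (word_mx k m).
Proof.
rewrite /word_mx /fdeg; elim: (m : seq bool) => [|i t IHt] /=.
  by rewrite big_nil; apply: mx_deg1.
rewrite big_cons -[X in X%:R]add1n natrD; apply: mx_degM => //.
by case: i; apply: mx_deg_anti.
Qed.

Lemma sjp_component_deg n b : @sjp_component k n b -> mx_deg n%:R (phi b).
Proof.
case=> f /= fn <-; rewrite sjp_mx_proj /free_mx mmapE big_seq.
apply: (big_ind (mx_deg n%:R)) => [||m mf]; [exact: mx_deg0|exact: mx_degD|].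
rewrite -[n%:R]add0r; apply: mx_degM; first exact: mx_deg_scalar.
by rewrite -(fn m mf); apply: word_mx_deg.
Qed.

(** Both generators are antidiagonal, so a word of length n has the parity of n. *)
Lemma sjp_part_deg i b : @sjp_part k i b -> mx_deg i (phi b).
Proof.
case=> N [h [hn ->]]; rewrite raddf_sum.
apply: (big_ind (mx_deg i)) => [||n /eqP <-]; [exact: mx_deg0|exact: mx_degD|].
exact/sjp_component_deg.
Qed.

Definition homogeneous_part (f : FA) n : FA :=
  \sum_(m <- msupp f | fdeg m == n) << f@_m *g m >>.

Lemma sjp_component_homogeneous f n : @sjp_component k n (sjp_proj (homogeneous_part f n)).
Proof.
exists (homogeneous_part f n) => //= m; rewrite -mcoeff_neq0; apply: contraNeq => mn.
rewrite /homogeneous_part raddf_sum big1 //= => m' /eqP m'n.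
by rewrite mcoeffU; case: eqP => // m'm; rewrite -m'n m'm eqxx in mn.
Qed.

Lemma sum_homogeneous_part f :
  exists N, f = \sum_(0 <= n < N) homogeneous_part f n.
Proof.
exists (\max_(m <- msupp f) (fdeg m).+1)%N; rewrite [LHS]monalgE.
rewrite /homogeneous_part (exchange_big_dep xpredT) //= big_seq [RHS]big_seq.
apply: eq_bigr => m mf; under eq_bigl => n do rewrite eq_sym.
have ltN : (fdeg m < \max_(m <- msupp f) (fdeg m).+1)%N.
  by apply: (leq_bigmax_seq (F := fun m => (fdeg m).+1)).
by rewrite big_nat1_eq ltN.
Qed.

Lemma sjp_partition (b : B) :
  exists b0 b1, [/\ @sjp_part k 0 b0, @sjp_part k 1 b1 & b = b0 + b1].
Proof.
pose f := sjp_repr b; have [N fE] := sum_homogeneous_part f.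
pose h n := sjp_proj (homogeneous_part f n) : B.
have hP i : @sjp_part k i (\sum_(0 <= n < N | n%:R == i) h n).
  by exists N, h; split=> // n; apply: sjp_component_homogeneous.
exists (\sum_(0 <= n < N | n%:R == 0 :> 'Z_2) h n),
  (\sum_(0 <= n < N | n%:R == 1 :> 'Z_2) h n).
split=> //; rewrite -[LHS]sjp_reprK -/f {1}fE.
rewrite (big_morph _ (@sjp_projD k) (@sjp_proj0 k)).
rewrite (bigID (fun n => n%:R == 0 :> 'Z_2)) /=; congr (_ + _).
by apply: eq_bigl => n; case: (ord2_cases n%:R) => ->.
Qed.

(** A faithful representation that respects parity also reflects it: the
    component of the wrong parity has a matrix of both parities, that is 0. *)
Lemma sjp_partP i (b : B) : @sjp_part k i b <-> mx_deg i (phi b).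
Proof.
split=> [|db]; first exact: sjp_part_deg.
have [b0 [b1 [p0 p1 bE]]] := sjp_partition b.
have [d0 d1] := (sjp_part_deg p0, sjp_part_deg p1).
have phi0 (c : B) : mx_deg 0 (phi c) -> mx_deg 1 (phi c) -> c = 0.
  move=> d0' d1'; apply: sjp_mx_inj; rewrite raddf0; exact: mx_deg_disjoint.
have dB (M N : 'M[J]_2) j : mx_deg j M -> mx_deg j (M + N) -> mx_deg j N.
  by move=> dM dMN a c ac; have := dMN a c ac; rewrite mxE dM ?add0r.
rewrite bE rmorphD in db.
have [i0|i1] := ord2_cases i; subst i.
  by rewrite bE (phi0 b1) ?addr0 //; apply: dB db.
by rewrite bE (phi0 b0) ?add0r //; apply: dB d1 _; rewrite addrC.
Qed.

End SuperJordanPlaneMatrices.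


(** * Ore localization by germs of linear maps *)

Definition right_denominator_set (B : pzRingType) (S : set B) : Prop :=
  [/\ S 1, forall s t, S s -> S t -> S (s * t), S `<=` regular_in setT & right_ore S].

(** A fraction a s^-1 is seen as the map s b |-> a b, right linear on the right
    ideal s B.  Maps on B that are right linear on some s B with s in S, taken up
    to agreement on some t B with t in S, are added pointwise and multiplied by
    composition; the ring axioms are then nearly immediate, and the Ore condition
    is what makes domains s B intersect and pull back. *)
Section OreLocalization.
Local Open Scope quotient_scope.
Variables (k : fieldType) (B : algType k) (S : set B).
Hypothesis SP : right_denominator_set S.

Let S1 : S 1. Proof. by case: SP. Qed.
Let SM s t : S s -> S t -> S (s * t). Proof. by case: SP => _ + _ _; apply. Qed.
Let Sreg : S `<=` regular_in setT. Proof. by case: SP. Qed.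
Let Sore : right_ore S. Proof. by case: SP. Qed.

Lemma right_ore_common_multiple s t : S s -> S t ->
  exists u v, S (s * u) /\ s * u = t * v.
Proof.
move=> Ss St; have [v [u [Su suE]]] := Sore t Ss.
by exists v, u; rewrite -suE; split=> //; apply: SM.
Qed.

Definition linear_on s (f : B -> B) := forall b, f (s * b) = f s * b.

Lemma linear_onM s u f : linear_on s f -> linear_on (s * u) f.
Proof. by move=> fs b; rewrite -mulrA !fs mulrA. Qed.

Definition is_germ (f : B -> B) := `[< exists2 s, S s & linear_on s f >].

Record germ := Germ { germ_fun :> B -> B; germP : is_germ germ_fun }.
HB.instance Definition _ := [isSub for germ_fun].
HB.instance Definition _ := gen_eqMixin germ.
HB.instance Definition _ := gen_choiceMixin germ.

Lemma germ_ext (f g : germ) : germ_fun f = germ_fun g -> f = g.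
Proof. exact: val_inj. Qed.

Definition agree (f g : germ) : bool :=
  `[< exists2 s, S s & forall b, f (s * b) = g (s * b) >].

Lemma agree_refl : reflexive agree.
Proof. by move=> f; apply/asboolP; exists 1. Qed.

Lemma agree_sym : symmetric agree.
Proof.
move=> f g; apply/asboolP/asboolP => -[s Ss fg]; exists s => // b; exact/esym/fg.
Qed.

Lemma agree_trans : transitive agree.
Proof.
move=> g f h /asboolP[s Ss fg] /asboolP[t St gh]; apply/asboolP.
have [u [v [Ssu suE]]] := right_ore_common_multiple Ss St.
by exists (s * u) => // b; rewrite -mulrA fg mulrA suE -mulrA gh.
Qed.

Canonical agree_equiv := EquivRel agree agree_refl agree_sym agree_trans.

Definition ore_localization := {eq_quot agree}.
Local Notation Q := ore_localization.
HB.instance Definition _ := Choice.on Q.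
HB.instance Definition _ := EqQuotient.on Q.

Lemma germ_addP (f g : germ) : is_germ (fun b => f b + g b).
Proof.
have /asboolP[s Ss fs] := germP f; have /asboolP[t St gt] := germP g.
have [u [v [Ssu suE]]] := right_ore_common_multiple Ss St.
apply/asboolP; exists (s * u) => // b; rewrite (linear_onM u fs).
by rewrite suE (linear_onM v gt) mulrDl.
Qed.
Definition germ_add f g := Germ (germ_addP f g).

Lemma germ_scaleP (c : k) (f : germ) : is_germ (fun b => c *: f b).
Proof.
have /asboolP[s Ss fs] := germP f; apply/asboolP; exists s => // b.
by rewrite fs scalerAl.
Qed.
Definition germ_scale c f := Germ (germ_scaleP c f).

Lemma germ_lmulP (a : B) : is_germ (fun b => a * b).
Proof. by apply/asboolP; exists 1 => // b; rewrite mul1r mulr1. Qed.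
Definition germ_lmul a := Germ (germ_lmulP a).

(** The Ore condition applied to g(s) and t: the germ g sends a smaller domain
    into t B. *)
Lemma germ_reach (g : germ) s t : S s -> linear_on s g -> S t ->
  exists2 u, S (s * u) & exists a, forall b, g (s * u * b) = t * (a * b).
Proof.
move=> Ss gs St; have [a [u [Su guE]]] := Sore (g s) St.
exists u; first exact: SM.
by exists a => b; rewrite -mulrA gs mulrA guE mulrA.
Qed.

Lemma germ_mulP (f g : germ) : is_germ (fun b => f (g b)).
Proof.
have /asboolP[s Ss fs] := germP f; have /asboolP[t St gt] := germP g.
have [u Stu [a gE]] := germ_reach St gt Ss.
apply/asboolP; exists (t * u) => // b; rewrite gE -[t * u in RHS]mulr1 gE.
by rewrite !fs mulr1 mulrA.
Qed.
Definition germ_mul f g := Germ (germ_mulP f g).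

Local Notation pi := (\pi_Q : germ -> Q).

Lemma pi_eq (f g : germ) : pi f = pi g <->
  exists2 s, S s & forall b, f (s * b) = g (s * b).
Proof.
split=> [/eqP|fg]; first by rewrite eqmodE => /asboolP.
by apply/eqP; rewrite eqmodE; apply/asboolP.
Qed.

Definition ol_add (p q : Q) : Q := pi (germ_add (repr p) (repr q)).
Definition ol_mul (p q : Q) : Q := pi (germ_mul (repr p) (repr q)).
Definition ol_scale (c : k) (p : Q) : Q := pi (germ_scale c (repr p)).

Lemma repr_pi f : exists2 s, S s & forall b, repr (pi f) (s * b) = f (s * b).
Proof. by apply/pi_eq; rewrite reprK. Qed.

Lemma pi_add f g : pi (germ_add f g) = ol_add (pi f) (pi g).
Proof.
have [s Ss fE] := repr_pi f; have [t St gE] := repr_pi g.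
have [u [v [Ssu suE]]] := right_ore_common_multiple Ss St.
apply/pi_eq; exists (s * u) => //= b; rewrite -mulrA fE mulrA suE.
by rewrite -mulrA gE.
Qed.

Lemma pi_scale c f : pi (germ_scale c f) = ol_scale c (pi f).
Proof.
by have [s Ss fE] := repr_pi f; apply/pi_eq; exists s => //= b; rewrite fE.
Qed.

Lemma pi_mul f g : pi (germ_mul f g) = ol_mul (pi f) (pi g).
Proof.
have [s Ss fE] := repr_pi f; have [t St gE] := repr_pi g.
have /asboolP[r Sr gr] := germP g.
have [u [v [Sru ruE]]] := right_ore_common_multiple Sr St.
have [u' Sruu' [a gaE]] := germ_reach Sru (linear_onM u gr) Ss.
apply/pi_eq; exists (r * u * u') => //= b.
have -> : repr (pi g) (r * u * u' * b) = g (r * u * u' * b).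
  by rewrite ruE -!mulrA gE.
by rewrite gaE fE.
Qed.

Lemma piW (R : Q -> Prop) : (forall f, R (pi f)) -> forall q, R q.
Proof. by move=> Rpi q; rewrite -[q]reprK; apply: Rpi. Qed.

Lemma ol_addA : associative ol_add.
Proof.
elim/piW=> f; elim/piW=> g; elim/piW=> h; rewrite -!pi_add; congr pi.
by apply: germ_ext; apply/funext=> b /=; rewrite addrA.
Qed.

Lemma ol_addC : commutative ol_add.
Proof.
elim/piW=> f; elim/piW=> g; rewrite -!pi_add; congr pi.
by apply: germ_ext; apply/funext=> b /=; rewrite addrC.
Qed.

Lemma ol_add0 : left_id (pi (germ_lmul 0)) ol_add.
Proof.
elim/piW=> f; rewrite -!pi_add; congr pi.
by apply: germ_ext; apply/funext=> b /=; rewrite mul0r add0r.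
Qed.

Lemma ol_addN : left_inverse (pi (germ_lmul 0)) (ol_scale (-1)) ol_add.
Proof.
elim/piW=> f; rewrite -!pi_scale -pi_add; congr pi.
by apply: germ_ext; apply/funext=> b /=; rewrite mul0r scaleN1r addNr.
Qed.

HB.instance Definition _ := GRing.isZmodule.Build Q ol_addA ol_addC ol_add0 ol_addN.

Lemma ol_mulA : associative ol_mul.
Proof.
elim/piW=> f; elim/piW=> g; elim/piW=> h; rewrite -!pi_mul; congr pi.
exact: germ_ext.
Qed.

Lemma ol_mul1 : left_id (pi (germ_lmul 1)) ol_mul.
Proof.
elim/piW=> f; rewrite -pi_mul; congr pi.
by apply: germ_ext; apply/funext=> b /=; rewrite mul1r.
Qed.

Lemma ol_mulr1 : right_id (pi (germ_lmul 1)) ol_mul.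
Proof.
elim/piW=> f; rewrite -pi_mul; congr pi.
by apply: germ_ext; apply/funext=> b /=; rewrite mul1r.
Qed.

Lemma ol_mulDl : left_distributive ol_mul ol_add.
Proof.
elim/piW=> f; elim/piW=> g; elim/piW=> h; rewrite -!(pi_mul, pi_add); congr pi.
exact: germ_ext.
Qed.

(** Left composition distributes only where f is additive, so the domain has to
    be shrunk until g and h both land in the domain of f. *)
Lemma ol_mulDr : right_distributive ol_mul ol_add.
Proof.
elim/piW=> f; elim/piW=> g; elim/piW=> h; rewrite -!(pi_mul, pi_add); apply/pi_eq.
have /asboolP[s Ss fs] := germP f; have /asboolP[t St gt] := germP g.
have /asboolP[r Sr hr] := germP h.
have [u Stu [a gE]] := germ_reach St gt Ss.
have [u' Sru' [a' hE]] := germ_reach Sr hr Ss.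
have [v [v' [Sv vE]]] := right_ore_common_multiple Stu Sru'.
exists (t * u * v) => //= b; rewrite -mulrA gE.
rewrite [t * u * (v * b)]mulrA vE -[in RHS]mulrA -mulrA hE -mulrDr !fs.
by rewrite mulrDr.
Qed.

Lemma ol_oner_neq0 : pi (germ_lmul 1) != 0 :> Q.
Proof.
apply/eqP => /pi_eq[s Ss /(_ 1)] /=; rewrite mul0r mul1r.
have [_ sreg _] := Sreg Ss; move/(sreg _ I)/eqP; exact/negP/oner_neq0.
Qed.

HB.instance Definition _ := GRing.Zmodule_isNzRing.Build Q
  ol_mulA ol_mul1 ol_mulr1 ol_mulDl ol_mulDr ol_oner_neq0.

Lemma ol_scaleA c d p : ol_scale c (ol_scale d p) = ol_scale (c * d) p.
Proof.
elim/piW: p => f; rewrite -!pi_scale; congr pi.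
by apply: germ_ext; apply/funext=> b /=; rewrite scalerA.
Qed.

Lemma ol_scale1 : left_id 1 ol_scale.
Proof.
elim/piW=> f; rewrite -!pi_scale; congr pi.
by apply: germ_ext; apply/funext=> b /=; rewrite scale1r.
Qed.

Lemma ol_scaleDr : right_distributive ol_scale ol_add.
Proof.
move=> c; elim/piW=> f; elim/piW=> g; rewrite -!(pi_scale, pi_add); congr pi.
by apply: germ_ext; apply/funext=> b /=; rewrite scalerDr.
Qed.

Lemma ol_scaleDl p : {morph ol_scale^~ p : c d / c + d >-> ol_add c d}.
Proof.
move=> c d; elim/piW: p => f; rewrite -!pi_scale -pi_add; congr pi.
by apply: germ_ext; apply/funext=> b /=; rewrite scalerDl.
Qed.

HB.instance Definition _ := GRing.Zmodule_isLmodule.Build k Q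
  ol_scaleA ol_scale1 ol_scaleDr ol_scaleDl.

Lemma ol_scaleAl c (p q : Q) : c *: (p * q) = c *: p * q.
Proof.
elim/piW: p => f; elim/piW: q => g.
rewrite -[LHS]/(ol_scale _ (ol_mul _ _)) -[RHS]/(ol_mul (ol_scale _ _) _).
by rewrite -pi_mul -!pi_scale -pi_mul; congr pi; apply: germ_ext.
Qed.

HB.instance Definition _ := GRing.Lmodule_isLalgebra.Build k Q ol_scaleAl.

Lemma ol_scaleAr c (p q : Q) : c *: (p * q) = p * (c *: q).
Proof.
elim/piW: p => f; elim/piW: q => g.
rewrite -[LHS]/(ol_scale _ (ol_mul _ _)) -[RHS]/(ol_mul _ (ol_scale _ _)).
rewrite -pi_mul -!pi_scale -pi_mul; apply/pi_eq.
have /asboolP[s Ss fs] := germP f; have /asboolP[t St gt] := germP g.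
have [u Stu [a gE]] := germ_reach St gt Ss.
by exists (t * u) => // b /=; rewrite gE scalerAr !fs scalerAr.
Qed.

HB.instance Definition _ := GRing.Lalgebra_isAlgebra.Build k Q ol_scaleAr.

Definition ol_inj (a : B) : Q := pi (germ_lmul a).

Fact ol_inj_is_zmod_morphism : zmod_morphism ol_inj.
Proof.
have injD a b : ol_inj (a + b) = ol_inj a + ol_inj b.
  rewrite -[RHS]/(ol_add _ _) -pi_add; congr pi.
  by apply: germ_ext; apply/funext=> c /=; rewrite mulrDl.
by move=> a b; apply: (addIr (ol_inj b)); rewrite -injD !subrK.
Qed.
HB.instance Definition _ := GRing.isZmodMorphism.Build B Q ol_inj
  ol_inj_is_zmod_morphism.

Fact ol_inj_is_monoid_morphism : monoid_morphism ol_inj.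
Proof.
split=> // a b; rewrite -[RHS]/(ol_mul _ _) -pi_mul; congr pi.
by apply: germ_ext; apply/funext=> c /=; rewrite mulrA.
Qed.
HB.instance Definition _ := GRing.isMonoidMorphism.Build B Q ol_inj
  ol_inj_is_monoid_morphism.

Fact ol_inj_is_scalable : scalable ol_inj.
Proof.
move=> c a; rewrite -[RHS]/(ol_scale _ _) -pi_scale; congr pi.
by apply: germ_ext; apply/funext=> b /=; rewrite scalerAl.
Qed.
HB.instance Definition _ := GRing.isScalable.Build k B Q *:%R ol_inj
  ol_inj_is_scalable.

(** The inverse of left multiplication by t is division by t on t B, extended by
    0; it is single-valued because t is regular. *)
Lemma ol_inj_unit t : S t -> exists u : Q, ol_inj t * u = 1 /\ u * ol_inj t = 1.
Proof.
move=> St; have [_ treg _] := Sreg St.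
pose g a : B := if pselect (exists b, a = t * b) is left ab then projT1 (cid ab) else 0.
have gE b : g (t * b) = b.
  rewrite /g; case: pselect => [ab|[]]; last by exists b.
  case: (cid ab) => b' /= tbE; apply/eqP; rewrite -subr_eq0; apply/eqP/treg => //.
  by rewrite mulrBr -tbE subrr.
have gP : is_germ g.
  by apply/asboolP; exists t => // b; rewrite gE -[t in RHS]mulr1 gE mul1r.
exists (pi (Germ gP)); split.
  rewrite -[LHS]/(ol_mul _ _) -pi_mul; apply/pi_eq; exists t => //= b.
  by rewrite gE mul1r.
rewrite -[LHS]/(ol_mul _ _) -pi_mul; congr pi.
by apply: germ_ext; apply/funext=> b /=; rewrite gE mul1r.
Qed.

(** A germ f linear on s B satisfies f s = f(s) as germs, hence f = f(s) s^-1. *)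
Lemma ol_fraction_ring : is_fraction_ring ol_inj setT S setT.
Proof.
split.
- by move=> t /ol_inj_unit[u [tu ut]]; exists u.
- apply/seteqP; split=> // q _; elim/piW: q => f.
  have /asboolP[s Ss fs] := germP f; have [u [su us]] := ol_inj_unit Ss.
  exists (f s), s, u; split=> //.
  have <- : pi f * ol_inj s = ol_inj (f s); last by rewrite -mulrA su mulr1.
  rewrite -[LHS]/(ol_mul _ _) -pi_mul; congr pi.
  by apply: germ_ext; apply/funext=> b /=; rewrite fs.
- move=> a _; split=> [/pi_eq[s Ss aE]|[t St at0]].
    by exists s => //; have := aE 1; rewrite /= mulr1 mul0r.
  by apply/pi_eq; exists t => // b /=; rewrite mulrA at0 !mul0r.
Qed.

End OreLocalization.

Theorem ore_localization_exists (k : fieldType) (B : algType k) (S : set B) :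
    right_denominator_set S ->
  exists (Q : algType k) (iota : {lrmorphism B -> Q}),
    is_fraction_ring iota setT S setT.
Proof.
by move=> SP; exists (ore_localization SP), (ol_inj SP); apply: ol_fraction_ring.
Qed.

(** * Superalgebras with two division blocks *)

Lemma decreasing_prop_stationary (P : nat -> Prop) : (forall n, P n.+1 -> P n) ->
  exists N, forall n, (N <= n)%N -> P n <-> P N.
Proof.
move=> Pdec.
have Pmono m n : (m <= n)%N -> P n -> P m.
  by move=> /subnK<-; elim: (n - m)%N => // i IHi /Pdec.
have [[N nPN]|allP] := pselect (exists N, ~ P N).
  by exists N => n le; split=> // /(Pmono _ _ le).
exists 0%N => n _; split=> _; apply: contrapT => nP; apply: allP; by eexists; exact: nP.
Qed.

(** A decreasing chain of sets that are determined by two membership questions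
    is stationary as soon as both answers are. *)
Lemma dcc_two_tests (k : fieldType) (A : algType k) (C : set A -> Prop) (e f : A) :
    (forall I I', C I -> C I' -> (I e -> I' e) -> (I f -> I' f) -> I `<=` I') ->
  dcc C.
Proof.
move=> tests I CI Idec.
have [M Me] := @decreasing_prop_stationary (I ^~ e) (fun n => Idec n e).
have [N Nf] := @decreasing_prop_stationary (I ^~ f) (fun n => Idec n f).
exists (maxn M N) => n; rewrite geq_max => /andP[leM leN].
have [e1 f1] := (Me n leM, Nf n leN).
have [e2 f2] := (Me _ (leq_maxl M N), Nf _ (leq_maxr M N)).
by apply/seteqP; split; apply: tests => //; tauto.
Qed.

(** The even part is a product of two division rings with identities e and f,
    which conjugation by an odd unit y exchanges.  Invertibility of q e in its
    factor is expressed by q' (q e) = e = (q e) q' with q' anywhere in A. *)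
Section TwoDivisionBlocks.
Variables (k : fieldType) (A : algType k) (G : 'Z_2 -> set A) (e f y y' : A).
Hypothesis gradG : superalgebra_grading G.
Hypotheses (Gy : G 1 y) (yy' : y * y' = 1) (y'y : y' * y = 1).
Hypothesis (ef1 : e + f = 1).
Hypothesis eC : forall q, G 0 q -> e * q = q * e.
Hypothesis ye : y * e = f * y.
Hypothesis e_div : forall q, G 0 q -> q * e != 0 ->
  exists q', q' * (q * e) = e /\ q * e * q' = e.
Hypothesis f_div : forall q, G 0 q -> q * f != 0 ->
  exists q', q' * (q * f) = f /\ q * f * q' = f.

Let fE : f = 1 - e. Proof. by rewrite -ef1 addrC addKr. Qed.

Let fC q : G 0 q -> f * q = q * f.
Proof. by move=> Gq; rewrite fE mulrBl mulrBr mul1r mulr1 eC. Qed.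

Let decomp a : exists a0 a1, [/\ G 0 a0, G 1 a1 & a = a0 + a1].
Proof. by case: gradG. Qed.

Let GM i j a b : G i a -> G j b -> G (i + j) (a * b).
Proof. by case: gradG => _ _ _ _; apply. Qed.

Let blocks (q : A) : q = q * e + q * f.
Proof. by rewrite -mulrDr ef1 mulr1. Qed.

(** A nonzero homogeneous element of a graded ideal becomes even after
    multiplication by y, one of its blocks is invertible in its factor, so the
    ideal contains e or f, and with one of them the other. *)
Lemma two_blocks_super_simple : super_simple G.
Proof.
split; first by exists 1; apply/eqP/oner_neq0.
move=> I [[I0 ID IL] [_ _ IR]] gI; apply: contrapT => /not_orP[In0 InT].
have fI : I e -> I f.
  by move=> Ie; rewrite -[f]mulr1 -yy' mulrA -ye; apply/IR/IL.
have eI : I f -> I e.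
  move=> If; rewrite -[e]mul1r -y'y -mulrA ye; apply/IL/IR => //.
have full : ~ I e.
  move=> Ie; apply: InT; apply/seteqP; split=> // a _.
  by rewrite -[a]mulr1 -ef1; apply/IL/ID => //; apply: fI.
have I0even q : G 0 q -> I q -> q = 0.
  move=> Gq Iq; rewrite [q]blocks.
  have [->|/(e_div Gq)[q' [qe _]]] := eqVneq (q * e) 0; last first.
    by case: full; rewrite -qe; apply/IL/IR.
  have [->|/(f_div Gq)[q' [qf _]]] := eqVneq (q * f) 0; first by rewrite addr0.
  by case: full; apply: eI; rewrite -qf; apply/IL/IR.
apply: In0; apply/seteqP; split=> [q Iq|_ ->] //=.
have [q0 [q1 [Gq0 Gq1 qE]]] := decomp q.
have [Iq0 Iq1] : I q0 /\ I q1 by apply: gI => //; rewrite -qE.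
rewrite qE (I0even _ Gq0 Iq0) add0r -[q1]mul1r -y'y -mulrA (I0even (y * q1)) ?mulr0 //.
  by have := GM Gy Gq1; rewrite (_ : 1 + 1 = 0 :> 'Z_2) //; apply: val_inj.
exact: IL.
Qed.

Let GyM q : G 1 q -> G 0 (y * q) /\ G 0 (q * y).
Proof.
have -> : 0 = 1 + 1 :> 'Z_2 by apply: val_inj.
by move=> Gq; split; apply: GM.
Qed.

(** A graded one-sided ideal is determined by its even part, as y is invertible,
    and the even part by whether it contains e and whether it contains f. *)
Lemma two_blocks_super_artinian : super_artinian G.
Proof.
split; apply: (@dcc_two_tests _ _ _ e f) => I I' [[I0 ID IM] gI] [[I'0 I'D I'M] gI'] ee ff.
  have even q : G 0 q -> I q -> I' q.
    move=> Gq Iq; rewrite [q]blocks; apply: I'D.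
      have [->//|/(e_div Gq)[q' [qe _]]] := eqVneq (q * e) 0.
      by apply/I'M/ee; rewrite -qe -eC //; apply/IM/IM.
    have [->//|/(f_div Gq)[q' [qf _]]] := eqVneq (q * f) 0.
    by apply/I'M/ff; rewrite -qf -fC //; apply/IM/IM.
  move=> q Iq; have [q0 [q1 [Gq0 Gq1 qE]]] := decomp q.
  have [Iq0 Iq1] : I q0 /\ I q1 by apply: gI => //; rewrite -qE.
  rewrite qE; apply: I'D; first exact: even.
  rewrite -[q1]mul1r -y'y -mulrA; apply/I'M/even; last exact: IM.
  by have [] := GyM Gq1.
have even q : G 0 q -> I q -> I' q.
  move=> Gq Iq; rewrite [q]blocks; apply: I'D.
    have [->//|/(e_div Gq)[q' [_ qe]]] := eqVneq (q * e) 0.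
    by rewrite -eC //; apply/I'M/ee; rewrite -qe; apply/IM/IM.
  have [->//|/(f_div Gq)[q' [_ qf]]] := eqVneq (q * f) 0.
  by rewrite -fC //; apply/I'M/ff; rewrite -qf; apply/IM/IM.
move=> q Iq; have [q0 [q1 [Gq0 Gq1 qE]]] := decomp q.
have [Iq0 Iq1] : I q0 /\ I q1 by apply: gI => //; rewrite -qE.
rewrite qE; apply: I'D; first exact: even.
rewrite -[q1]mulr1 -yy' mulrA; apply/I'M/even; last exact: IM.
by have [] := GyM Gq1.
Qed.
End TwoDivisionBlocks.

(** * Orders in a matrix ring over an Ore domain *)

(** What is used of the super Jordan plane B: it embeds into the two by two
    matrices over a left and right Ore domain R with parity given by diagonal
    and antidiagonal, its image contains the scalar matrices and s M_2(R), and y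
    is mapped to w E12 + E21. *)
Section MatrixOrder.
Variables (k : fieldType) (B : algType k) (B_ : 'Z_2 -> set B).
Variables (R : nzRingType) (s w : R) (phi : {rmorphism B -> 'M[R]_2}) (y : B).
Hypotheses (left_oreR : left_ore_domain R) (right_oreR : left_ore_domain R^c).
Hypotheses (s_neq0 : s != 0) (w_neq0 : w != 0).
Hypothesis phi_inj : injective phi.
Hypothesis phi_lift : forall M, exists b, phi b = s%:M * M.
Hypothesis phi_scalar : forall f, exists b, phi b = f%:M.
Hypothesis phiA : forall c, mx_deg 0 (phi c%:A).
Hypothesis phiy : phi y = mx2 0 w 1 0.
Hypothesis B_P : forall i b, B_ i b <-> mx_deg i (phi b).
Hypothesis B_decomp : forall b, exists b0 b1, [/\ B_ 0 b0, B_ 1 b1 & b = b0 + b1].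

Let S0 : set B := regular_in (B_ 0).
Let S : set B := (B_ 0 `|` B_ 1) `&` regular_in setT.

Let domR (p q : R) : p != 0 -> q != 0 -> p * q != 0.
Proof. by case: left_oreR => dom _; apply: dom. Qed.

Let mulR_eq0 (p q : R) : p != 0 -> p * q = 0 -> q = 0.
Proof. by move=> p0 /eqP; apply: contraTeq => q0; apply: domR. Qed.

Let mulR_eq0r (p q : R) : p != 0 -> q * p = 0 -> q = 0.
Proof. by move=> p0 /eqP; apply: contraTeq => q0; apply: domR. Qed.

Let BM i j b c : B_ i b -> B_ j c -> B_ (i + j) (b * c).
Proof. by move=> /B_P db /B_P dc; apply/B_P; rewrite rmorphM; apply: mx_degM. Qed.

Let B11M b c : B_ 1 b -> B_ 1 c -> B_ 0 (b * c).
Proof. by move=> db dc; have := BM db dc; rewrite (_ : 1 + 1 = 0) //; apply: val_inj. Qed.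

Let B1 : B_ 0 1. Proof. by apply/B_P; rewrite rmorph1; apply: mx_deg1. Qed.

Let By : B_ 1 y. Proof. by apply/B_P; rewrite phiy; apply: mx_deg_anti. Qed.

Let diag_regular p q d : p != 0 -> q != 0 -> phi d = mx2 p 0 0 q ->
  regular_in setT d.
Proof.
move=> p0 q0 dE; split=> // b _ db0; apply: phi_inj; rewrite rmorph0;
  move: (congr1 phi db0); rewrite rmorphM rmorph0 dE [phi b]mx2E mx2M;
  rewrite !(mul0r, mulr0, addr0, add0r) => /mx2_eq0[].
- move=> /(mulR_eq0 p0)-> /(mulR_eq0 p0)-> /(mulR_eq0 q0)-> /(mulR_eq0 q0)->.
  exact: mx2_0.
- move=> /(mulR_eq0r p0)-> /(mulR_eq0r q0)-> /(mulR_eq0r p0)-> /(mulR_eq0r q0)->.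
  exact: mx2_0.
Qed.

(** If an entry of the diagonal of d vanishes, then d kills s E11 or s E22, which
    are in the image. *)
Lemma even_regularP d :
  S0 d <-> exists p q, [/\ p != 0, q != 0 & phi d = mx2 p 0 0 q].
Proof.
split=> [[/B_P/mx_deg0E dE dreg _]|[p [q [p0 q0 dE]]]].
  have [a aE] := phi_lift (mx2 1 0 0 0); have [b bE] := phi_lift (mx2 0 0 0 1).
  rewrite mx2_scalar mx2M !(mul0r, mulr0, addr0, add0r, mulr1) in aE.
  rewrite mx2_scalar mx2M !(mul0r, mulr0, addr0, add0r, mulr1) in bE.
  have B0a : B_ 0 a by apply/B_P; rewrite aE; apply: mx_deg_diag.
  have B0b : B_ 0 b by apply/B_P; rewrite bE; apply: mx_deg_diag.
  exists (phi d 0 0), (phi d 1 1); split=> //; apply/eqP=> d0; rewrite d0 in dE.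
    have /(dreg a B0a) a0 : d * a = 0.
      apply: phi_inj; rewrite rmorphM dE aE mx2M rmorph0.
      by rewrite !(mul0r, mulr0, addr0, add0r) mx2_0.
    move/eqP: s_neq0; apply; have := congr1 (fun M : 'M_2 => M 0 0) aE.
    by rewrite a0 rmorph0 !mxE.
  have /(dreg b B0b) b0 : d * b = 0.
    apply: phi_inj; rewrite rmorphM dE bE mx2M rmorph0.
    by rewrite !(mul0r, mulr0, addr0, add0r) mx2_0.
  move/eqP: s_neq0; apply; have := congr1 (fun M : 'M_2 => M 1 1) bE.
  by rewrite b0 rmorph0 !mxE.
have [_ lreg rreg] := diag_regular p0 q0 dE.
split=> [|b _|b _]; [|exact: lreg|exact: rreg].
by apply/B_P; rewrite dE; apply: mx_deg_diag.
Qed.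

Lemma even_regular_regular : S0 `<=` regular_in setT.
Proof. by move=> d /even_regularP[p [q [p0 q0 dE]]]; apply: diag_regular dE. Qed.

Let S0B d : S0 d -> B_ 0 d. Proof. by case. Qed.

Let S0S : S0 `<=` S.
Proof. by move=> d S0d; split; [left; apply: S0B|apply: even_regular_regular]. Qed.

Let S01 : S0 1.
Proof. by split=> // b _; rewrite ?mul1r ?mulr1. Qed.

Let S0M c d : S0 c -> S0 d -> S0 (c * d).
Proof.
move=> /even_regularP[p [q [p0 q0 cE]]] /even_regularP[p' [q' [p'0 q'0 dE]]].
apply/even_regularP; exists (p * p'), (q * q'); split; rewrite ?domR //.
by rewrite rmorphM cE dE mx2M !(mul0r, mulr0, addr0, add0r).
Qed.

Let regM (c d : B) : regular_in setT c -> regular_in setT d -> regular_in setT (c * d).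
Proof.
move=> [_ cl cr] [_ dl dr]; split=> // b _.
  by rewrite -mulrA => /(cl _ I)/(dl _ I).
by rewrite mulrA => /(dr _ I)/(cr _ I).
Qed.

Let even_S d : B_ 0 d -> regular_in setT d -> S0 d.
Proof. by move=> B0d [_ dl dr]; split=> // b _; [apply: dl|apply: dr]. Qed.

Lemma odd_regular_sq d : B_ 1 d -> regular_in setT d -> S0 (d * d).
Proof. by move=> B1d rd; apply: even_S; [apply: B11M|apply: regM]. Qed.

(** Clearing denominators entrywise: a common u with b_ij u in d_i s R makes
    b u = d s V, and s V is in the image. *)
Lemma even_regular_right_ore : right_ore S0.
Proof.
move=> b d /even_regularP[p [q [p0 q0 dE]]]; rewrite /=.
pose den (i : 'I_2) := if i == 0 then p else q.
pose F := [seq (phi b ij.1 ij.2, den ij.1 * s) | ij : 'I_2 * 'I_2].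
have [|u u0 uE] := @common_denominator R^c F right_oreR.
  apply/allP=> _ /mapP[[i j] _ ->] /=; apply: domR => //.
  by rewrite /den; case: ifP.
have /choice[v vE] : forall ij : 'I_2 * 'I_2, exists v : R,
    phi b ij.1 ij.2 * u = den ij.1 * s * v.
  by move=> ij; apply: (uE (phi b ij.1 ij.2, den ij.1 * s));
    apply/mapP; exists ij; rewrite ?mem_enum.
have [d' d'E] := phi_scalar u.
have [b' b'E] := phi_lift (\matrix_(i, j) v (i, j)).
exists b', d'; split; first by apply/even_regularP; exists u, u; rewrite d'E mx2_scalar.
apply: phi_inj; rewrite !rmorphM b'E d'E dE !mx2_scalar [phi b]mx2E.
rewrite [X in _ = _ * (_ * X)]mx2E !mx2M.
rewrite !(mul0r, mulr0, addr0, add0r) !mxE !mulrA.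
by congr mx2; [apply: (vE (0, 0))|apply: (vE (0, 1))
              |apply: (vE (1, 0))|apply: (vE (1, 1))].
Qed.

(** With u b = V d for a common nonzero u, multiplying by s on the left brings V
    into the image. *)
Lemma even_regular_left_ore : left_ore S0.
Proof.
move=> b d /even_regularP[p [q [p0 q0 dE]]]; rewrite /=.
pose den (i : 'I_2) := if i == 0 then p else q.
pose F := [seq (phi b ij.1 ij.2, den ij.2) | ij : 'I_2 * 'I_2].
have [|u u0 uE] := @common_denominator R F left_oreR.
  by apply/allP=> _ /mapP[[i j] _ ->] /=; rewrite /den; case: ifP.
have /choice[v vE] : forall ij : 'I_2 * 'I_2, exists v : R,
    u * phi b ij.1 ij.2 = v * den ij.2.
  by move=> ij; apply: (uE (phi b ij.1 ij.2, den ij.2));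
    apply/mapP; exists ij; rewrite ?mem_enum.
have [d' d'E] := phi_scalar (s * u).
have [b' b'E] := phi_lift (\matrix_(i, j) v (i, j)).
exists b', d'; split.
  by apply/even_regularP; exists (s * u), (s * u); rewrite d'E mx2_scalar !domR.
apply: phi_inj; rewrite !rmorphM b'E d'E dE !mx2_scalar [phi b]mx2E.
rewrite [X in _ = _ * X * _]mx2E !mx2M.
rewrite !(mul0r, mulr0, addr0, add0r) !mxE -!mulrA.
by congr mx2; congr (_ * _); [apply: (vE (0, 0))|apply: (vE (0, 1))
                             |apply: (vE (1, 0))|apply: (vE (1, 1))].
Qed.

(** An odd regular t has an even regular square, and a right multiple of t^2 is a
    right multiple of t. *)
Lemma homogeneous_right_ore : right_ore S.
Proof.
move=> b t [[B0t|B1t] rt].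
  have [b' [t' [S0t' btE]]] := even_regular_right_ore b (even_S B0t rt).
  by exists b', t'; split=> //; apply: S0S.
have [b' [t' [S0t' btE]]] := even_regular_right_ore b (odd_regular_sq B1t rt).
by exists (t * b'), t'; rewrite mulrA; split=> //; apply: S0S.
Qed.

Lemma homogeneous_left_ore : left_ore S.
Proof.
move=> b t [[B0t|B1t] rt].
  have [b' [t' [S0t' btE]]] := even_regular_left_ore b (even_S B0t rt).
  by exists b', t'; split=> //; apply: S0S.
have [b' [t' [S0t' btE]]] := even_regular_left_ore b (odd_regular_sq B1t rt).
by exists (b' * t), t'; rewrite -mulrA; split=> //; apply: S0S.
Qed.

Lemma homogeneous_denominators : right_denominator_set S.
Proof.
split; [exact: S0S| | by move=> t []|exact: homogeneous_right_ore].
move=> t t' [ht rt] [ht' rt']; split; last exact: regM.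
case: ht ht' => ht [] ht'; [left|right|right|left]; last exact: B11M.
- by rewrite -[0](addr0 0); apply: BM.
- by rewrite -[1](add0r 1); apply: BM.
- by rewrite -[1](addr0 1); apply: BM.
Qed.

(** * Fractions with even denominators *)

Section Fractions.
Variables (Q : algType k) (iota : {lrmorphism B -> Q}).
Hypothesis fracQ : is_fraction_ring iota setT S setT.

Definition inverse_of t (u : Q) := iota t * u = 1 /\ u * iota t = 1.

Definition fraction_part i : set Q := [set q | exists a t u,
  [/\ B_ i a, S0 t, iota t * u = 1, u * iota t = 1 & q = iota a * u]].
Local Notation Q_ := fraction_part.

Let S0_inv t : S0 t -> exists u, inverse_of t u.
Proof. by case: fracQ => inv _ _ /S0S/inv[u [_ tu ut]]; exists u. Qed.

Let iota_inj b : iota b = 0 -> b = 0.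
Proof.
case: fracQ => _ _ ker /(ker b I)[t [_ [_ _ treg]]]; exact: treg.
Qed.

Let inverse_unique t u v : inverse_of t u -> iota t * v = 1 -> v = u.
Proof. by move=> [_ ut] tv; rewrite -[u]mulr1 -tv mulrA ut mul1r. Qed.

Let inverseM t t' u u' : inverse_of t u -> inverse_of t' u' ->
  inverse_of (t * t') (u' * u).
Proof.
move=> [tu ut] [tu' ut']; rewrite /inverse_of rmorphM /= !mulrA; split.
  by rewrite -[iota t * _ * _]mulrA tu' mulr1.
by rewrite -[u' * u * _]mulrA ut mulr1.
Qed.

Let B_disjoint b : B_ 0 b -> B_ 1 b -> b = 0.
Proof.
move=> /B_P d0 /B_P d1; apply: phi_inj; rewrite rmorph0; exact: mx_deg_disjoint.
Qed.

Let BD i b c : B_ i b -> B_ i c -> B_ i (b + c).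
Proof. by move=> /B_P db /B_P dc; apply/B_P; rewrite rmorphD; apply: mx_degD. Qed.

Let BZ i (c : k) b : B_ i b -> B_ i (c *: b).
Proof.
move=> /B_P db; apply/B_P; rewrite -[b]mul1r scalerAl rmorphM -[i]add0r.
exact: mx_degM.
Qed.

Let BN i b : B_ i b -> B_ i (- b). Proof. by rewrite -scaleN1r; apply: BZ. Qed.

(** As t is even and regular, the component of b' of the parity other than that
    of b is killed by t. *)
Lemma homogeneous_ore i b t : B_ i b -> S0 t ->
  exists b' t', [/\ B_ i b', S0 t' & b * t' = t * b'].
Proof.
move=> Bb S0t; have [b' [t' [S0t' btE]]] := even_regular_right_ore b S0t.
have Bbt : B_ i (t * b').
  by rewrite -btE -[i]addr0; apply: BM => //; apply: S0B.
have [_ treg _] := even_regular_regular S0t.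
have [b0 [b1 [Bb0 Bb1 b'E]]] := B_decomp b'.
have Btb0 : B_ 0 (t * b0) by rewrite -[0](addr0 0); apply: BM => //; apply: S0B.
have Btb1 : B_ 1 (t * b1) by rewrite -[1](add0r 1); apply: BM => //; apply: S0B.
exists b', t'; split=> //; rewrite b'E.
have [i0|i1] := ord2_cases i; subst i.
  rewrite (treg b1 I) ?addr0 //; apply: B_disjoint => //.
  by rewrite -[t * b1](addKr (t * b0)) -mulrDr -b'E; apply/BD => //; apply: BN.
rewrite (treg b0 I) ?add0r //; apply: B_disjoint => //.
by rewrite -[t * b0](addrK (t * b1)) -mulrDr -b'E; apply/BD => //; apply: BN.
Qed.

Lemma fraction_common i j q q' : Q_ i q -> Q_ j q' ->
  exists b b' x, [/\ exists2 r, S0 r & inverse_of r x, B_ i b, B_ j b',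
                     q = iota b * x & q' = iota b' * x].
Proof.
move=> [b [t [u [Bb S0t tu ut ->]]]] [b' [t' [u' [Bb' S0t' tu' ut' ->]]]].
have [v [v' [Bv S0v' vE]]] := homogeneous_ore (S0B S0t') S0t.
have S0r : S0 (t' * v') by apply: S0M.
have [x [rx xr]] := S0_inv S0r.
exists (b * v), (b' * v'), x; split.
- by exists (t' * v').
- by rewrite -[i]addr0; apply: BM.
- by rewrite -[j]addr0; apply: BM => //; apply: S0B.
- rewrite rmorphM -mulrA; congr (_ * _); apply/esym/(@inverse_unique t) => //.
  by rewrite mulrA -rmorphM -vE.
- rewrite rmorphM -mulrA; congr (_ * _); apply/esym/(@inverse_unique t') => //.
  by rewrite mulrA -rmorphM.
Qed.

(** An odd denominator t is replaced by t^2, as t^-1 = t (t^2)^-1. *)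
Lemma even_fractions q : exists a t u, [/\ S0 t, inverse_of t u & q = iota a * u].
Proof.
have [_ QE _] := fracQ.
have : [set: Q] q by []. rewrite QE => -[a [t [u [_ [[B0t|B1t] rt] tu ut ->]]]].
  by exists a, t, u; split=> //; apply: even_S.
exists (a * t), (t * t), (u * u); split; first exact: odd_regular_sq.
  exact: inverseM.
by rewrite rmorphM -mulrA [iota t * _]mulrA tu mul1r.
Qed.

Lemma fraction_part_iota i b : B_ i b -> Q_ i (iota b).
Proof. by exists b, 1, 1; rewrite !rmorph1 !mulr1. Qed.

Lemma fraction_grading : superalgebra_grading Q_.
Proof.
split.
- move=> i; split=> [|c q q' Qq Qq'].
    by rewrite -(rmorph0 iota); apply/fraction_part_iota/B_P; rewrite rmorph0; apply: mx_deg0.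
  have [b [b' [x [[r S0r [rx xr]] Bb Bb' -> ->]]]] := fraction_common Qq Qq'.
  exists (c *: b + b'), r, x; split=> //; first by apply: BD => //; apply: BZ.
  by rewrite linearP mulrDl scalerAl.
- move=> q; have [b [t [u [S0t [tu ut] ->]]]] := even_fractions q.
  have [b0 [b1 [Bb0 Bb1 ->]]] := B_decomp b.
  exists (iota b0 * u), (iota b1 * u); rewrite rmorphD mulrDl.
  by split=> //; [exists b0, t, u|exists b1, t, u].
- move=> q Q0q Q1q.
  have [b [b' [x [[r S0r [rx xr]] Bb Bb' -> E]]]] := fraction_common Q0q Q1q.
  suff -> : b = 0 by rewrite rmorph0 mul0r.
  apply: B_disjoint => //; suff -> : b = b' by [].
  apply/eqP; rewrite -subr_eq0; apply/eqP/iota_inj.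
  rewrite rmorphB /=; apply/eqP; rewrite subr_eq0; apply/eqP.
  by rewrite -[LHS]mulr1 -[RHS]mulr1 -xr !mulrA E.
- by rewrite -(rmorph1 iota); apply: fraction_part_iota.
- move=> i j _ _ [b [t [u [Bb S0t tu ut ->]]]] [b' [t' [u' [Bb' S0t' tu' ut' ->]]]].
  have [b1 [t1 [Bb1 S0t1 tE]]] := homogeneous_ore Bb' S0t.
  have [x1 [tx1 xt1]] := S0_inv S0t1.
  have [tx xt] : inverse_of (t' * t1) (x1 * u') by apply: inverseM.
  exists (b * b1), (t' * t1), (x1 * u'); split=> //; [exact: BM|exact: S0M|].
  rewrite rmorphM -!mulrA; congr (_ * _); rewrite !mulrA; congr (_ * _).
  rewrite -[iota b']mulr1 -tx1 [iota b' * _]mulrA -[iota b' * _]rmorphM tE rmorphM.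
  by rewrite !mulrA ut mul1r.
Qed.

Lemma even_part_fraction_ring : is_fraction_ring iota (B_ 0) S0 (Q_ 0).
Proof.
split=> // [t S0t|a _].
  have [u [tu ut]] := S0_inv S0t; exists u; split=> //.
  by exists 1, t, u; rewrite rmorph1 mul1r.
split=> [/iota_inj ->|[t S0t]]; first by exists 1; rewrite ?mul0r.
by have [_ _ treg] := even_regular_regular S0t => /(treg _ I)->; rewrite rmorph0.
Qed.

Lemma even_denominators_fraction_ring : is_fraction_ring iota setT S0 setT.
Proof.
split=> [t S0t||a _].
- by have [u [tu ut]] := S0_inv S0t; exists u.
- apply/seteqP; split=> // q _; have [a [t [u [S0t [tu ut] qE]]]] := even_fractions q.
  by exists a, t, u.
split=> [/iota_inj ->|[t S0t]]; first by exists 1; rewrite ?mul0r.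
by have [_ _ treg] := even_regular_regular S0t => /(treg _ I)->; rewrite rmorph0.
Qed.

(** With e = a z^-1, an even fraction q = d u satisfies q e = c e z^-1 u where
    c = d a + b is completed by b on the other block; c is regular, hence a unit,
    and everything in sight commutes with e. *)
Lemma block_division (a b : B) (zi : Q) : B_ 0 a -> B_ 0 b -> a * b = 0 -> b * a = 0 ->
    S0 (a + b) -> inverse_of (a + b) zi ->
    (forall q, Q_ 0 q -> iota a * zi * q = q * (iota a * zi)) ->
    (forall d, B_ 0 d -> d * a != 0 -> S0 (d * a + b)) ->
  forall q, Q_ 0 q -> q * (iota a * zi) != 0 ->
  exists q', q' * (q * (iota a * zi)) = iota a * zi /\
             q * (iota a * zi) * q' = iota a * zi.
Proof.
move=> Ba Bb ab0 ba0 S0z [zzi ziz] eC S0c q [d [t [u [Bd S0t tu ut ->]]]] qe0.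
set e := iota a * zi in eC qe0 *; set z := a + b in S0z zzi ziz.
have inv_even r v : S0 r -> inverse_of r v -> Q_ 0 v.
  by move=> S0r [rv vr]; exists 1, r, v; rewrite rmorph1 mul1r.
have eu : e * u = u * e by apply/eC/(inv_even t).
have ezi : e * zi = zi * e by apply/eC/(inv_even z).
have da0 : d * a != 0.
  apply: contraNneq qe0 => da0.
  by rewrite -mulrA -eu !mulrA -[iota d * iota a]rmorphM da0 rmorph0 !mul0r.
have S0da := S0c d Bd da0; have [v vP] := S0_inv S0da; have [cv vc] := vP.
have ev : e * v = v * e by apply/eC/(inv_even _ _ S0da).
have ce : iota (d * a + b) * e = iota (d * a).
  rewrite /e mulrA -rmorphM mulrDl ba0 addr0 -mulrA.
  have -> : a * a = a * z by rewrite mulrDr ab0 addr0.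
  by rewrite mulrA rmorphM -mulrA zzi mulr1.
have qeE : iota d * u * e = iota (d * a + b) * e * (zi * u).
  by rewrite ce -mulrA -eu /e rmorphM !mulrA.
clearbody e; exists (iota t * iota z * v); rewrite qeE; split.
  rewrite -!mulrA [v * _]mulrA vc mul1r [e * _]mulrA ezi -[zi * e * u]mulrA eu.
  by rewrite [iota z * _]mulrA zzi mul1r mulrA tu mul1r.
rewrite !mulrA -[_ * u * iota t]mulrA ut mulr1 -[_ * zi * iota z]mulrA ziz mulr1.
by rewrite -mulrA ev mulrA cv mul1r.
Qed.

(** The idempotents are e = a z^-1 and f = b z^-1, where a = s E11, b = s E22 and
    z = a + b are in the image; the odd unit is y, whose square is diag(w, w). *)
Lemma fractions_simple_artinian : super_simple Q_ /\ super_artinian Q_.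
Proof.
have [a] := phi_lift (mx2 1 0 0 0); have [b] := phi_lift (mx2 0 0 0 1).
rewrite !mx2_scalar !mx2M !(mul0r, mulr0, addr0, add0r, mulr1) => bE aE.
have Ba : B_ 0 a by apply/B_P; rewrite aE; apply: mx_deg_diag.
have Bb : B_ 0 b by apply/B_P; rewrite bE; apply: mx_deg_diag.
have ab0 : a * b = 0.
  by apply: phi_inj; rewrite rmorphM aE bE mx2M !(mulr0, mul0r, addr0) mx2_0 rmorph0.
have ba0 : b * a = 0.
  by apply: phi_inj; rewrite rmorphM aE bE mx2M !(mulr0, mul0r, addr0) mx2_0 rmorph0.
pose z := a + b.
have zE : phi z = mx2 s 0 0 s by rewrite rmorphD aE bE mx2D !(addr0, add0r).
have S0z : S0 z by apply/even_regularP; exists s, s.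
have [zi zP] := S0_inv S0z; have [zzi ziz] := zP.
pose e := iota a * zi; pose f := iota b * zi.
have [y' [yy' y'y]] : exists y', iota y * y' = 1 /\ y' * iota y = 1.
  have S0yy : S0 (y * y).
    apply/even_regularP; exists w, w; rewrite rmorphM phiy mx2M.
    by rewrite !(mulr0, mul0r, addr0, add0r, mulr1, mul1r).
  have [x []] := S0_inv S0yy; rewrite rmorphM => yx xy.
  have yxE : iota y * x = x * iota y.
    rewrite -[LHS]mul1r -xy -[RHS]mulr1 -yx.
    by rewrite -!mulrA.
  exists (iota y * x); rewrite mulrA yx; split=> //.
  by rewrite yxE -mulrA xy.
have ef1 : e + f = 1 by rewrite -mulrDl -rmorphD.
have zcancel (c c' : Q) : iota z * c = iota z * c' -> c = c'.
  by move=> cc; rewrite -[c]mul1r -ziz -mulrA cc mulrA ziz mul1r.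
have iM (c d : B) : iota (c * d) = iota c * iota d by rewrite rmorphM.
have zdiv (c : B) : c * z = z * c -> iota z * (iota c * zi) = iota c.
  by move=> cz; rewrite mulrA -rmorphM -cz rmorphM /= -mulrA zzi mulr1.
(* z is not central, as s need not commute with the entries of d; the relation
   c d z = z d c is what remains of the centrality of c z^-1. *)
have central (c : B) : (forall d, B_ 0 d -> c * d * z = z * d * c) ->
    c * z = z * c -> B_ 0 c -> forall q, Q_ 0 q -> iota c * zi * q = q * (iota c * zi).
  move=> cd cz Bc.
  have zc := zdiv c cz.
  have main d : B_ 0 d -> iota c * zi * iota d = iota d * (iota c * zi).
    move=> Bd; apply: zcancel; rewrite mulrA zc -rmorphM.
    by rewrite !mulrA -!iM -(cd d Bd) (iM _ z) -mulrA zzi mulr1.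
  move=> _ [d [t [u [Bd S0t tu ut ->]]]].
  move: (iota c * zi) main => g main; rewrite mulrA main // -!mulrA; congr (_ * _).
  rewrite -[g * u]mul1r -ut -mulrA [iota t * _]mulrA -main; last exact: S0B.
  by rewrite -[g * _ * u]mulrA tu mulr1.
have even_mx d : B_ 0 d -> exists p q, phi d = mx2 p 0 0 q.
  by move=> /B_P/mx_deg0E dE; exists (phi d 0 0), (phi d 1 1).
have eC : forall q, Q_ 0 q -> e * q = q * e.
  apply: central => // [d /even_mx[p [q dE]]|];
    apply: phi_inj; rewrite !rmorphM ?dE aE zE !mx2M;
    by rewrite !(mulr0, mul0r, addr0, add0r) ?mulrA.
have fC : forall q, Q_ 0 q -> f * q = q * f.
  apply: central => // [d /even_mx[p [q dE]]|];
    apply: phi_inj; rewrite !rmorphM ?dE bE zE !mx2M;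
    by rewrite !(mulr0, mul0r, addr0, add0r) ?mulrA.
have bz : b * z = z * b.
  by apply: phi_inj; rewrite !rmorphM bE zE !mx2M !(mulr0, mul0r, addr0, add0r).
have ye : iota y * e = f * iota y.
  have zya : z * y * a = b * y * z.
    apply: phi_inj; rewrite !rmorphM aE bE zE phiy !mx2M.
    by rewrite !(mulr0, mul0r, addr0, add0r, mulr1, mul1r).
  apply: zcancel; rewrite [RHS]mulrA (zdiv b bz) !mulrA -!iM zya.
  by rewrite (iM _ z) -mulrA zzi mulr1.
have S0ab d : B_ 0 d -> d * a != 0 -> S0 (d * a + b).
  move=> /B_P/mx_deg0E dE da0; apply/even_regularP; exists (phi d 0 0 * s), s.
  split=> //; last first.
    rewrite rmorphD rmorphM dE aE bE mx2M mx2D.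
    by rewrite !mxE /= !(mulr0, mul0r, addr0, add0r).
  apply: domR => //; apply: contraNneq da0 => d0; apply/eqP/phi_inj.
  by rewrite rmorphM dE aE mx2M d0 rmorph0 !(mulr0, mul0r, addr0, add0r) mx2_0.
have S0ba d : B_ 0 d -> d * b != 0 -> S0 (d * b + a).
  move=> /B_P/mx_deg0E dE da0; apply/even_regularP; exists s, (phi d 1 1 * s).
  split=> //; last first.
    rewrite rmorphD rmorphM dE aE bE mx2M mx2D.
    by rewrite !mxE /= !(mulr0, mul0r, addr0, add0r).
  apply: domR => //; apply: contraNneq da0 => d0; apply/eqP/phi_inj.
  by rewrite rmorphM dE bE mx2M d0 rmorph0 !(mulr0, mul0r, addr0, add0r) mx2_0.
have e_div := block_division Ba Bb ab0 ba0 S0z zP eC S0ab.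
have f_div : forall q, Q_ 0 q -> q * f != 0 ->
    exists q', q' * (q * f) = f /\ q * f * q' = f.
  by apply: (block_division Bb Ba ba0 ab0 _ _ fC S0ba); rewrite addrC.
have Qy := fraction_part_iota By.
split.
  exact: (two_blocks_super_simple fraction_grading Qy yy' y'y ef1 ye e_div f_div).
exact: (two_blocks_super_artinian fraction_grading Qy yy' y'y ef1 eC e_div f_div).
Qed.

End Fractions.

End MatrixOrder.

(** * The total ring of fractions of the super Jordan plane *)

Theorem theorem4p9 (k : fieldType) (hk : 2%N \notin [pchar k]) :
  let B := super_jordan_plane k in
  let B_ : 'Z_2 -> set B := @sjp_part k in
  let S0 : set B := regular_in (B_ 0) in
  let S : set B := (B_ 0 `|` B_ 1) `&` regular_in setT in
  [/\ left_ore S /\ right_ore S,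
      exists (Q : algType k) (iota : {lrmorphism B -> Q}),
        is_fraction_ring iota setT S setT
    & forall (Q : algType k) (iota : {lrmorphism B -> Q}),
        is_fraction_ring iota setT S setT ->
        exists Q_ : 'Z_2 -> set Q,
          [/\ superalgebra_grading Q_
                /\ (forall i b, B_ i b -> Q_ i (iota b)),
              is_fraction_ring iota (B_ 0) S0 (Q_ 0),
              is_fraction_ring iota setT S0 setT
            & super_simple Q_ /\ super_artinian Q_]].
Proof.
move=> B B_ S0 S.
have [lo ro] := (@jordan_left_ore k, @jordan_right_ore k).
pose phi : {rmorphism B -> 'M[jordan_plane k]_2} := @sjp_mx k.
pose s : jordan_plane k := jordan_s k.
have s0 : s != 0 by rewrite polyC_eq0 polyX_eq0.
have w0 : (jordan_w k : jordan_plane k) != 0 by rewrite polyX_eq0.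
have phi_inj : injective phi by apply: sjp_mx_inj.
have lift M : exists b, phi b = s%:M * M by apply: sjp_mx_lift.
have scalar f : exists b, phi b = f%:M by apply: sjp_mx_scalar.
have phiA c : mx_deg 0 (phi c%:A).
  by rewrite [phi _]sjp_mx_alg; apply: mx_deg_scalar.
have partP i b : B_ i b <-> mx_deg i (phi b) by apply: sjp_partP.
have partition := @sjp_partition k.
have phiy : phi _ = _ := @sjp_mx_y k.
split.
- split; first exact: (homogeneous_left_ore lo s0 phi_inj lift scalar partP).
  exact: (homogeneous_right_ore lo ro s0 phi_inj lift scalar partP).
- apply: ore_localization_exists.
  exact: (homogeneous_denominators lo ro s0 phi_inj lift scalar partP).
move=> Q iota fracQ; exists (fraction_part B_ iota); split.
- split; last by move=> i b; apply: (fraction_part_iota partP).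
  exact: (fraction_grading lo ro s0 phi_inj lift scalar phiA partP partition fracQ).
- exact: (even_part_fraction_ring lo s0 phi_inj lift partP fracQ).
- exact: (even_denominators_fraction_ring lo s0 phi_inj lift partP fracQ).
exact: (fractions_simple_artinian lo ro s0 w0 phi_inj lift scalar phiA phiy partP
  partition fracQ).
Qed.
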